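(* Let $X,U$ be Hilbert spaces, let $A$ generate a strongly continuous semigroup $T(t)$ on $X$, let $B\in\mathcal{B}(U,X)$, let $F\in\mathcal{B}(X,U)$ be compact, and assume $BF\ne0$. Assume that the semigroup $T_{BF}(t)$ generated by $A+BF$ satisfies $\|T_{BF}(t)\|_{\mathcal{B}(X)}\le\Gamma e^{-\gamma t}$ for all $t\ge0$, for some $\Gamma\ge1$ and $\gamma>0$. For every $\tau_{\max}>0$, if $\varepsilon\ge0$ and $\tau_{\min}\in(0,\tau_{\max})$ satisfy $$\varepsilon<\frac{\gamma e^{-\gamma\tau_{\min}}-\Gamma\sup_{0\le\tau\le\tau_{\min}}\|BF(I-\Delta_\tau)\|_{\mathcal{B}(X)}}{e^{\gamma\tau_{\min}}\,\Gamma\,\|BF\|_{\mathcal{B}(X)}},$$ then the closed-loop system without perturbation ($\phi\equiv0$) with the event-triggering mechanism (described in the context) with parameters $\varepsilon,\tau_{\min},\tau_{\max}$ is exponentially stable.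
   Context: $\mathcal{B}(Y,Z)$ is the space of bounded linear operators from $Y$ to $Z$, $\mathcal{B}(X)=\mathcal{B}(X,X)$, $\mathbb{N}_0=\{0,1,2,\dots\}$, and $\|\cdot\|$ is the norm of $X$. Operators: $S_\tau:=\int_0^\tau T(s)B\,ds$ and $\Delta_\tau:=T(\tau)+S_\tau F$. Closed-loop system (unperturbed): $\dot x(t)=Ax(t)+Bu(t)$, $t\ge0$, $x(0)=x^0\in X$, with $u(t)=Fx(t_k)$ for $t_k\le t<t_{k+1}$, $k\in\mathbb{N}_0$. Its (mild) solution is the function $x\in C([0,\infty),X)$ with $x(0)=x^0$ and $$x(t_k+\tau)=T(\tau)x(t_k)+\int_0^\tau T(\tau-s)BFx(t_k)\,ds$$ for all $\tau\in(0,t_{k+1}-t_k]$, $k\in\mathbb{N}_0$. Event-triggering mechanism with threshold $\varepsilon\ge0$ and bounds $0<\tau_{\min}<\tau_{\max}$: $t_0:=0$, $t_{k+1}:=\min\{t_k+\tau_{\max},\bar t_{k+1}\}$, where $$\bar t_{k+1}:=\inf\{t>t_k+\tau_{\min}:\|x(t_k)-x(t)\|>\varepsilon\|x(t_k)\|\},\quad k\in\mathbb{N}_0$$ (with $\inf\emptyset=\infty$). The times and the solution are generated recursively: in the definition of $\bar t_{k+1}$, $x(t)$ for $t>t_k$ is the trajectory obtained by keeping the input $u=Fx(t_k)$ after $t_k$. Exponential stability of the closed-loop system: there exist constants $\Gamma_0\ge1$, $\gamma_0>0$ such that the solution satisfies $\|x(t)\|\le\Gamma_0e^{-\gamma_0t}\|x^0\|$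 for all $x^0\in X$ and all $t\ge0$. *)

(* Defs.v *)
From Stdlib Require Import Reals.
From Coquelicot Require Import Coquelicot.
Open Scope R_scope.

Set Implicit Arguments.

Inductive scalar_field := RealField | ComplexField.

Definition scalars (k : scalar_field) : AbsRing :=
  match k with RealField => R_AbsRing | ComplexField => C_AbsRing end.

Definition of_real (k : scalar_field) : R -> scalars k :=
  match k with RealField => fun a => a | ComplexField => RtoC end.

Definition scalar_conj (k : scalar_field) : scalars k -> scalars k :=
  match k with RealField => fun a => a | ComplexField => Cconj end.

(* Completeness is that of the underlying [CompleteNormedModule]; positivity and
   definiteness of [inner] follow from [inner_norm]. *)
Record Hilbert (k : scalar_field) := {
  space :> CompleteNormedModule (scalars k);
  inner : space -> space -> scalars k;
  inner_plus : forall x y z, inner (plus x y) z = plus (inner x z) (inner y z);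
  inner_scal : forall a x y, inner (scal a x) y = mult a (inner x y);
  inner_conj : forall x y, inner y x = scalar_conj k (inner x y);
  inner_norm : forall x, inner x x = of_real k (norm x ^ 2)
}.

(* Coquelicot integrates functions with values in modules over the reals, so a
   space over either field is also viewed as a real space, with the same carrier,
   uniform structure and norm. *)

Section RealRestriction.

Context {k : scalar_field} (X : CompleteNormedModule (scalars k)).

Definition rscal (a : R) (x : X) : X :=
  scal (of_real k a) x.

Lemma of_real_plus (a b : R) :
  of_real k (a + b) = plus (of_real k a) (of_real k b).
Proof. destruct k; [reflexivity | apply RtoC_plus]. Qed.

Lemma of_real_mult (a b : R) :
  of_real k (a * b) = mult (of_real k a) (of_real k b).
Proof. destruct k; [reflexivity | apply RtoC_mult]. Qed.

Lemma of_real_one : of_real k 1 = one.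
Proof. destruct k; reflexivity. Qed.

Lemma abs_of_real (a : R) : abs (of_real k a) = Rabs a.
Proof. destruct k; [reflexivity | apply Cmod_R]. Qed.

Lemma rscal_assoc (a b : R) (x : X) : rscal a (rscal b x) = rscal (a * b) x.
Proof. unfold rscal; rewrite of_real_mult; exact (scal_assoc (of_real k a) (of_real k b) x). Qed.

Lemma rscal_one (x : X) : rscal 1 x = x.
Proof. unfold rscal; rewrite of_real_one; exact (scal_one x). Qed.

Lemma rscal_plus_r (a : R) (x y : X) :
  rscal a (plus x y) = plus (rscal a x) (rscal a y).
Proof. exact (scal_distr_l (of_real k a) x y). Qed.

Lemma rscal_plus_l (a b : R) (x : X) :
  rscal (a + b) x = plus (rscal a x) (rscal b x).
Proof. unfold rscal; rewrite of_real_plus; exact (scal_distr_r (of_real k a) (of_real k b) x). Qed.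

Definition real_ModuleSpace_mixin :=
  ModuleSpace.Mixin R_Ring X rscal
    rscal_assoc rscal_one rscal_plus_r rscal_plus_l.

Definition real_NormedModuleAux : NormedModuleAux R_AbsRing :=
  NormedModuleAux.Pack R_AbsRing X
    (NormedModuleAux.Class R_AbsRing X
       (ModuleSpace.Class R_Ring X _ real_ModuleSpace_mixin)
       (UniformSpace.class X)) X.

Lemma norm_rscal (a : R) (x : X) : norm (rscal a x) <= Rabs a * norm x.
Proof. unfold rscal; rewrite <- abs_of_real; exact (norm_scal (of_real k a) x). Qed.

Definition real_NormedModule_mixin :=
  NormedModule.Mixin R_AbsRing real_NormedModuleAux
    (norm : X -> R) (norm_factor (V := X))
    norm_triangle norm_rscal norm_compat1 norm_compat2 norm_eq_zero.

Definition realify : CompleteNormedModule R_AbsRing :=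
  CompleteNormedModule.Pack R_AbsRing X
    (CompleteNormedModule.Class R_AbsRing X
       (NormedModule.Class R_AbsRing X _ real_NormedModule_mixin)
       (CompleteNormedModule.mixin _ _ (CompleteNormedModule.class _ X))) X.

End RealRestriction.

Definition integral {k : scalar_field} {X : Hilbert k}
  (f : R -> X) (a b : R) : X := RInt (V := realify X) f a b.

(* [real] sends infinite values to 0: meaningful for bounded [L] only. *)
Definition op_norm {k : scalar_field} {X Y : Hilbert k} (L : X -> Y) : R :=
  real (Lub_Rbar (fun r => exists x : X, norm x <= 1 /\ r = norm (L x))).

Definition compact_operator {k : scalar_field} {X Y : Hilbert k} (L : X -> Y) :=
  is_linear L /\
  forall x : nat -> X, (exists M, forall n, norm (x n) <= M) ->
    exists (phi : nat -> nat) (y : Y),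
      (forall n, (phi n < phi (S n))%nat) /\
      filterlim (fun n => L (x (phi n))) eventually (locally y).

(* A partially defined operator: [act] is meaningful on [dom] only. *)
Record operator {k : scalar_field} (X : Hilbert k) := {
  dom : X -> Prop;
  act : X -> X
}.

Definition op_plus {k : scalar_field} {X : Hilbert k}
  (A : operator X) (L : X -> X) : operator X :=
  {| dom := dom A; act := fun x => plus (act A x) (L x) |}.

Record C0_semigroup {k : scalar_field} {X : Hilbert k} (T : R -> X -> X) : Prop := {
  semigroup_bounded : forall t, 0 <= t -> is_linear (T t);
  semigroup_zero : forall x, T 0 x = x;
  semigroup_plus : forall t s x, 0 <= t -> 0 <= s -> T (t + s) x = T t (T s x);
  semigroup_cont : forall x, filterlim (fun t => T t x) (at_right 0) (locally x)
}.

Definition generates {k : scalar_field} {X : Hilbert k}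
  (A : operator X) (T : R -> X -> X) : Prop :=
  C0_semigroup T /\
  forall x y : X,
    (dom A x /\ act A x = y) <->
    filterlim (fun t => scal (of_real k (/ t)) (minus (T t x) x))
      (at_right 0) (locally y).

Section ClosedLoop.

Context {k : scalar_field} {X U : Hilbert k}.
Variables (T : R -> X -> X) (B : U -> X) (F : X -> U).

Definition S_op (tau : R) (u : U) : X := integral (fun s => T s (B u)) 0 tau.

Definition Delta_op (tau : R) (x : X) : X := plus (T tau x) (S_op tau (F x)).

(* State reached after time [tau] from [z] with the constant input [F z]. *)
Definition held_flow (z : X) (tau : R) : X :=
  plus (T tau z) (integral (fun s => T (tau - s) (B (F z))) 0 tau).

Variables (eps tau_min tau_max : R).

(* [Glb_Rbar] of the empty set is [p_infty]. *)
Definition trigger_time (tk : R) (z : X) : Rbar :=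
  Glb_Rbar (fun t => tk + tau_min < t /\
                     norm (minus z (held_flow z (t - tk))) > eps * norm z).

Record closed_loop_solution (x0 : X) (t : nat -> R) (x : R -> X) : Prop := {
  times_zero : t 0%nat = 0;
  times_succ : forall j, Finite (t (S j)) =
    Rbar_min (Finite (t j + tau_max)) (trigger_time (t j) (x (t j)));
  solution_cont : continuous_on (fun s => 0 <= s) x;
  solution_zero : x 0 = x0;
  solution_step : forall j tau, 0 < tau <= t (S j) - t j ->
    x (t j + tau) = held_flow (x (t j)) tau
}.

(* The first conjunct under the quantifier on [x0] records that "the solution"
   denotes, so that the decay estimate is not about an empty class. *)
Definition exponentially_stable : Prop :=
  exists Gamma0 gamma0 : R, 1 <= Gamma0 /\ 0 < gamma0 /\
    forall x0 : X,
      (exists t x, closed_loop_solution x0 t x) /\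
      forall t x, closed_loop_solution x0 t x ->
        forall s, 0 <= s -> norm (x s) <= Gamma0 * exp (- gamma0 * s) * norm x0.

End ClosedLoop.

(* Main.v *)
Require Import Defs.
From Stdlib Require Import Reals ZArith Lra Lia.
From Stdlib Require Import Classical IndefiniteDescription FunctionalExtensionality.
From Coquelicot Require Import Coquelicot.
Open Scope R_scope.

(** Write L for BF. Let z be the state at some event and v(s) the state a time s
    later, up to the next event. Then v' = (A + L) v + L (z - v): the loop follows
    the stable semigroup generated by A + L, disturbed by the sampling error z - v.

    In the norm N(x) = sup over t >= 0 of exp(gamma t) |T_BF(t) x|, which satisfies
    |x| <= N(x) <= Gamma |x|, the stable semigroup obeys
    N(T_BF(h) x) <= exp(- gamma h) N(x). So the right derivative of N(v) is at most
    - gamma N(v) + Gamma |L (z - v)|. During the first tau_min units of time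
    |L (z - v)| <= m |z|, where m is the supremum in the bound on the threshold;
    afterwards |L (z - v)| <= eps |L| |z|, because no event has been triggered. The
    bound on eps gives Gamma m < gamma and Gamma eps |L| < gamma
    ([threshold_margins]). Integrating, N(v) never exceeds N(z), and at the next
    event it is at most theta N(z), with theta < 1 the same for all intervals
    ([feedback_nonincreasing], [feedback_contraction]). Since events are at most
    tau_max apart, this is exponential decay ([solution_decay]).

    The differential equation makes sense only for v in the domain of A. For z in the
    domain, v stays there, and by the definition of the two generators
    (T_BF(h) u - T(h) u) / h tends to L u for u in the domain. This yields the bound
    on the right difference quotients of N(v) without a variation of constants
    formula ([feedback_right_step]), and a Gronwall inequality for right difference
    quotients integrates it ([right_gronwall]). The integrated estimate is continuous
    in z, so it extends from the domain, which is dense, to the whole space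
    ([feedback_growth]).

    Continuity of orbits, the density argument and the finiteness of the supremum m
    all rest on the boundedness of T on bounded time intervals
    ([semigroup_locally_bounded]), a consequence of the uniform boundedness
    principle, which is proved by a gliding hump. Solutions exist because events
    are at least tau_min apart: the flows between events are glued together
    ([closed_loop_solution_exists]). *)

(** * Linear identities in modules over the reals *)

Section LinearCombinations.

Context {V : ModuleSpace R_Ring}.

Inductive vexpr :=
  | VAtom (i : nat)
  | VZero
  | VPlus (a b : vexpr)
  | VOpp (a : vexpr)
  | VScal (r : R) (a : vexpr).

Fixpoint vval (env : list V) (e : vexpr) : V :=
  match e with
  | VAtom i => List.nth i env zero
  | VZero => zero
  | VPlus a b => plus (vval env a) (vval env b)
  | VOpp a => opp (vval env a)
  | VScal r a => scal r (vval env a)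
  end.

Fixpoint coeff (e : vexpr) (i : nat) : R :=
  match e with
  | VAtom j => if Nat.eqb i j then 1 else 0
  | VZero => 0
  | VPlus a b => coeff a i + coeff b i
  | VOpp a => - coeff a i
  | VScal r a => r * coeff a i
  end.

Fixpoint lincomb (c : nat -> R) (env : list V) : V :=
  match env with
  | nil => zero
  | cons x env' => plus (scal (c 0%nat) x) (lincomb (fun i => c (S i)) env')
  end.

Lemma lincomb_zero (env : list V) : lincomb (fun _ => 0) env = zero.
Proof.
  induction env as [|x env IH]; cbn [lincomb]; [reflexivity|].
  rewrite IH, plus_zero_r. exact (scal_zero_l x).
Qed.

Lemma lincomb_plus (c d : nat -> R) (env : list V) :
  lincomb (fun i => c i + d i) env = plus (lincomb c env) (lincomb d env).
Proof.
  revert c d; induction env as [|x env IH]; intros c d; cbn [lincomb].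
  - now rewrite plus_zero_l.
  - rewrite (IH (fun i => c (S i)) (fun i => d (S i))).
    rewrite (scal_distr_r (c 0%nat) (d 0%nat) x : scal (c 0%nat + d 0%nat) x = _).
    rewrite <- !plus_assoc. apply f_equal.
    rewrite (plus_comm _ (plus _ (lincomb (fun i => d (S i)) env))).
    rewrite <- plus_assoc. apply f_equal. apply plus_comm.
Qed.

Lemma lincomb_scal (r : R) (c : nat -> R) (env : list V) :
  lincomb (fun i => r * c i) env = scal r (lincomb c env).
Proof.
  revert c; induction env as [|x env IH]; intros c; cbn [lincomb].
  - now rewrite scal_zero_r.
  - rewrite (IH (fun i => c (S i))), scal_distr_l, scal_assoc. reflexivity.
Qed.

Lemma lincomb_opp (c : nat -> R) (env : list V) :
  lincomb (fun i => - c i) env = opp (lincomb c env).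
Proof.
  revert c; induction env as [|x env IH]; intros c; cbn [lincomb].
  - symmetry; exact opp_zero.
  - rewrite (IH (fun i => c (S i))), (@opp_plus V). apply f_equal2; [|reflexivity].
    exact (scal_opp_l (c 0%nat) x).
Qed.

Lemma lincomb_atom (j : nat) (env : list V) :
  lincomb (fun i => if Nat.eqb i j then 1 else 0) env = List.nth j env zero.
Proof.
  revert j; induction env as [|x env IH]; intros [|j]; cbn [lincomb Nat.eqb List.nth]; try reflexivity.
  - rewrite lincomb_zero, plus_zero_r. exact (scal_one x).
  - rewrite IH. rewrite (scal_zero_l x : scal 0 x = zero). apply plus_zero_l.
Qed.

Lemma vval_lincomb (env : list V) (e : vexpr) :
  vval env e = lincomb (coeff e) env.
Proof.
  induction e as [i| |a IHa b IHb|a IHa|r a IHa]; cbn [vval coeff].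
  - symmetry; apply lincomb_atom.
  - symmetry; apply lincomb_zero.
  - now rewrite IHa, IHb, <- lincomb_plus.
  - now rewrite IHa, <- lincomb_opp.
  - now rewrite IHa, <- lincomb_scal.
Qed.

Lemma vval_eq (env : list V) (e1 e2 : vexpr) :
  lincomb (coeff e1) env = lincomb (coeff e2) env -> vval env e1 = vval env e2.
Proof. now rewrite !vval_lincomb. Qed.

End LinearCombinations.

Ltac atom_index x env :=
  lazymatch env with
  | cons x _ => constr:(0%nat)
  | cons _ ?env' => let n := atom_index x env' in constr:(S n)
  end.

Ltac has_atom x env :=
  lazymatch env with
  | nil => constr:(false)
  | cons x _ => constr:(true)
  | cons _ ?env' => has_atom x env'
  end.

Ltac collect_atoms t env :=
  lazymatch t with
  | plus ?a ?b => let env := collect_atoms a env in collect_atoms b env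
  | minus ?a ?b => let env := collect_atoms a env in collect_atoms b env
  | opp ?a => collect_atoms a env
  | scal _ ?a => collect_atoms a env
  | zero => env
  | _ => lazymatch has_atom t env with
         | true => env
         | false => constr:(cons t env)
         end
  end.

Ltac reify t env :=
  lazymatch t with
  | plus ?a ?b =>
      let a := reify a env in let b := reify b env in constr:(VPlus a b)
  | minus ?a ?b =>
      let a := reify a env in let b := reify b env in constr:(VPlus a (VOpp b))
  | opp ?a => let a := reify a env in constr:(VOpp a)
  | scal ?r ?a => let a := reify a env in constr:(VScal r a)
  | zero => constr:(VZero)
  | _ => let i := atom_index t env in constr:(VAtom i)
  end.

Ltac coefficients_eq :=
  lazymatch goal with |- @eq _ ?a ?b => change (@eq R a b) end;
  try ring; try field.

(** Decides an equation between linear combinations by comparing the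
    coefficients of each atom in the field of real numbers. *)
Ltac module_eq :=
  lazymatch goal with
  | |- @eq ?T ?a ?b =>
      let env := collect_atoms a (@nil T) in
      let env := collect_atoms b env in
      let ea := reify a env in
      let eb := reify b env in
      refine (vval_eq env ea eb _);
      cbn [lincomb coeff Nat.eqb];
      repeat (apply f_equal2; [apply f_equal2; [coefficients_eq | reflexivity] |]);
      try reflexivity
  end.

(** The group operations of a complete normed module are found through a
    different path of canonical structures than in lemmas about normed modules;
    arithmetic tactics need a common path to recognize equal norms. *)
Ltac normed_structures :=
  repeat match goal with
  | |- context [CompleteNormedModule.AbelianGroup ?K ?V] =>
      change (CompleteNormedModule.AbelianGroup K V)
        with (NormedModule.AbelianGroup K (CompleteNormedModule.NormedModule K V))
  | |- context [CompleteNormedModule.AbelianMonoid ?K ?V] =>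
      change (CompleteNormedModule.AbelianMonoid K V)
        with (NormedModule.AbelianMonoid K (CompleteNormedModule.NormedModule K V))
  | |- context [CompleteNormedModule.ModuleSpace ?K ?V] =>
      change (CompleteNormedModule.ModuleSpace K V)
        with (NormedModule.ModuleSpace K (CompleteNormedModule.NormedModule K V))
  | |- context [ModuleSpace.AbelianGroup ?K (NormedModule.ModuleSpace ?A ?V)] =>
      change (ModuleSpace.AbelianGroup K (NormedModule.ModuleSpace A V))
        with (NormedModule.AbelianGroup A V)
  | |- context [ModuleSpace.AbelianMonoid ?K (NormedModule.ModuleSpace ?A ?V)] =>
      change (ModuleSpace.AbelianMonoid K (NormedModule.ModuleSpace A V))
        with (NormedModule.AbelianMonoid A V)
  | |- context [AbelianMonoid.Pack (AbelianGroup.sort (NormedModule.AbelianGroup ?A ?V)) ?c ?s] =>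
      change (AbelianMonoid.Pack (AbelianGroup.sort (NormedModule.AbelianGroup A V)) c s)
        with (NormedModule.AbelianMonoid A V)
  | H : context [CompleteNormedModule.AbelianGroup ?K ?V] |- _ =>
      change (CompleteNormedModule.AbelianGroup K V)
        with (NormedModule.AbelianGroup K (CompleteNormedModule.NormedModule K V)) in H
  | H : context [CompleteNormedModule.AbelianMonoid ?K ?V] |- _ =>
      change (CompleteNormedModule.AbelianMonoid K V)
        with (NormedModule.AbelianMonoid K (CompleteNormedModule.NormedModule K V)) in H
  | H : context [CompleteNormedModule.ModuleSpace ?K ?V] |- _ =>
      change (CompleteNormedModule.ModuleSpace K V)
        with (NormedModule.ModuleSpace K (CompleteNormedModule.NormedModule K V)) in H
  | H : context [ModuleSpace.AbelianGroup ?K (NormedModule.ModuleSpace ?A ?V)] |- _ =>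
      change (ModuleSpace.AbelianGroup K (NormedModule.ModuleSpace A V))
        with (NormedModule.AbelianGroup A V) in H
  | H : context [ModuleSpace.AbelianMonoid ?K (NormedModule.ModuleSpace ?A ?V)] |- _ =>
      change (ModuleSpace.AbelianMonoid K (NormedModule.ModuleSpace A V))
        with (NormedModule.AbelianMonoid A V) in H
  | H : context [AbelianMonoid.Pack (AbelianGroup.sort (NormedModule.AbelianGroup ?A ?V)) ?c ?s] |- _ =>
      change (AbelianMonoid.Pack (AbelianGroup.sort (NormedModule.AbelianGroup A V)) c s)
        with (NormedModule.AbelianMonoid A V) in H
  end.

(** * Norms, limits and operator norms *)

Section NormedSpaces.

Context {V : NormedModule R_AbsRing}.

(** The axioms of a normed module give only an inequality here; over the reals
    the converse follows by scaling back with [/ a]. *)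
Lemma norm_scal_real (a : R) (x : V) : norm (scal a x) = Rabs a * norm x.
Proof.
  apply Rle_antisym; [exact (norm_scal a x)|].
  destruct (Req_dec a 0) as [->|Ha].
  - rewrite Rabs_R0, Rmult_0_l. apply norm_ge_0.
  - assert (Hx : x = scal (/ a) (scal a x)).
    { rewrite scal_assoc. change (x = scal (/ a * a) x).
      rewrite Rinv_l by assumption. symmetry; exact (scal_one x). }
    assert (H : norm x <= / Rabs a * norm (scal a x)).
    { rewrite <- Rabs_inv. rewrite Hx at 1. exact (norm_scal (/ a) (scal a x)). }
    assert (0 < Rabs a) by now apply Rabs_pos_lt.
    apply (Rmult_le_compat_l (Rabs a)) in H; [|lra].
    now rewrite <- Rmult_assoc, Rinv_r, Rmult_1_l in H by lra.
Qed.

Lemma norm_minus_diag (x : V) : norm (minus x x) = 0.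
Proof. rewrite minus_eq_zero. exact norm_zero. Qed.

Lemma norm_minus_sym (x y : V) : norm (minus x y) = norm (minus y x).
Proof. now rewrite <- (opp_minus y x), norm_opp. Qed.

Lemma norm_minus_triangle (x y z : V) :
  norm (minus x z) <= norm (minus x y) + norm (minus y z).
Proof. rewrite (minus_trans y x z). apply norm_triangle. Qed.

Lemma norm_minus_le (x y : V) : norm (minus x y) <= norm x + norm y.
Proof. unfold minus. rewrite <- (norm_opp y). apply norm_triangle. Qed.

Lemma norm_le_minus (x y : V) : norm x <= norm y + norm (minus x y).
Proof.
  replace x with (plus y (minus x y)) at 1 by module_eq.
  apply norm_triangle.
Qed.

(** Clears the denominator of a difference quotient, so that derivatives can be
    estimated through increments. *)
Lemma norm_difference_quotient (h : R) (x y : V) : 0 < h ->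
  norm (minus (G := V) (scal (/ h) x) y) = / h * norm (minus x (scal h y)).
Proof.
  intros Hh.
  replace (minus (G := V) (scal (/ h) x) y) with (scal (/ h) (minus x (scal h y)))
    by (module_eq; lra).
  rewrite norm_scal_real, Rabs_right; [reflexivity|].
  apply Rle_ge, Rlt_le, Rinv_0_lt_compat, Hh.
Qed.

Lemma filterlim_norm_iff {T : Type} {Flt : (T -> Prop) -> Prop} {FF : Filter Flt}
  (f : T -> V) (y : V) :
  filterlim f Flt (locally y) <->
  forall e, 0 < e -> Flt (fun x => norm (minus (f x) y) < e).
Proof.
  rewrite (filterlim_locally_ball_norm f y). split; intros H.
  - intros e He. exact (H (mkposreal e He)).
  - intros e. exact (H e (cond_pos e)).
Qed.

Lemma at_right_zero_iff (P : R -> Prop) :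
  at_right 0 P <-> exists d, 0 < d /\ forall h, 0 < h < d -> P h.
Proof.
  split.
  - intros [d Hd]. exists d; split; [apply cond_pos|].
    intros h [H1 H2]. apply Hd; [|exact H1].
    change (Rabs (h - 0) < d). rewrite Rminus_0_r, Rabs_right; lra.
  - intros [d [Hd H]]. exists (mkposreal d Hd). intros h Hh Hpos.
    change (Rabs (h - 0) < d) in Hh.
    rewrite Rminus_0_r, Rabs_right in Hh by lra. apply H; lra.
Qed.

Lemma right_limit_iff (f : R -> V) (y : V) :
  filterlim f (at_right 0) (locally y) <->
  forall e, 0 < e -> exists d, 0 < d /\
    forall h, 0 < h < d -> norm (minus (f h) y) < e.
Proof.
  rewrite (filterlim_norm_iff f y). 
  split; intros H e He; specialize (H e He); now apply at_right_zero_iff.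
Qed.

Lemma continuous_norm_iff (f : R -> V) (s : R) :
  continuous f s <->
  forall e, 0 < e -> exists d, 0 < d /\
    forall r, Rabs (r - s) < d -> norm (minus (f r) (f s)) < e.
Proof.
  unfold continuous. rewrite (filterlim_norm_iff f (f s)).
  split; intros H e He; specialize (H e He).
  - destruct H as [d Hd]. exists d; split; [apply cond_pos|].
    intros r Hr. now apply Hd.
  - destruct H as [d [Hd H]]. exists (mkposreal d Hd). intros r Hr. now apply H.
Qed.

End NormedSpaces.

Section Suprema.

Variables (E : R -> Prop) (C : R).
Hypothesis HC : forall r, E r -> r <= C.

(** The real part of a supremum is an upper bound only if the supremum is
    finite; [C] guarantees this. *)
Lemma real_Lub_ge (r : R) : E r -> r <= real (Lub_Rbar E).
Proof.
  intros Hr. destruct (Lub_Rbar_correct E) as [Hub Hleast].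
  specialize (Hub r Hr). specialize (Hleast C HC).
  destruct (Lub_Rbar E); simpl in *; tauto.
Qed.

Lemma real_Lub_le : (exists r, E r) -> real (Lub_Rbar E) <= C.
Proof.
  intros [r Hr]. destruct (Lub_Rbar_correct E) as [Hub Hleast].
  specialize (Hub r Hr). specialize (Hleast C HC).
  destruct (Lub_Rbar E); simpl in *; tauto.
Qed.

End Suprema.

Section OperatorNorm.

Context {V W : NormedModule R_AbsRing}.

Definition operator_norm (L : V -> W) : R :=
  real (Lub_Rbar (fun r => exists x : V, norm x <= 1 /\ r = norm (L x))).

Lemma unit_ball_image_nonempty (L : V -> W) :
  exists r, exists x : V, norm x <= 1 /\ r = norm (L x).
Proof.
  exists (norm (L zero)), zero. split; [|reflexivity].
  apply Rle_trans with 0; [right; exact norm_zero|lra].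
Qed.

Lemma operator_norm_le (L : V -> W) (C : R) :
  0 <= C -> (forall x, norm (L x) <= C * norm x) -> operator_norm L <= C.
Proof.
  intros HC HL. apply real_Lub_le; [|apply unit_ball_image_nonempty].
  intros r [x [Hx ->]]. apply Rle_trans with (1 := HL x). nra.
Qed.

Lemma operator_norm_bound (L : V -> W) : is_linear L ->
  forall x, norm (L x) <= operator_norm L * norm x.
Proof.
  intros HL x. destruct (linear_norm L HL) as [M [HM HLM]].
  assert (Hunit : forall y, norm y <= 1 -> norm (L y) <= operator_norm L).
  { intros y Hy. apply (real_Lub_ge _ M); [|now exists y].
    intros r [z [Hz ->]]. specialize (HLM z). nra. }
  destruct (Req_dec (norm x) 0) as [H0|H0].
  - specialize (HLM x). rewrite H0 in *. lra.
  - pose proof (norm_ge_0 x) as Hx.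
    specialize (Hunit (scal (/ norm x) x)).
    rewrite (linear_scal L HL), !norm_scal_real, !Rabs_inv, !Rabs_right in Hunit by lra.
    assert (Hi : / norm x * norm x = 1) by (apply Rinv_l; lra).
    rewrite Hi in Hunit. specialize (Hunit (Rle_refl 1)).
    replace (norm (L x)) with (/ norm x * norm (L x) * norm x) by (field; lra).
    apply Rmult_le_compat_r; [exact Hx|]. exact Hunit.
Qed.

Lemma operator_norm_nearly_attained (L : V -> W) (c : R) :
  c < operator_norm L -> exists u, norm u <= 1 /\ c < norm (L u).
Proof.
  intros Hc. apply NNPP. intros Hno.
  apply (Rlt_not_le _ _ Hc).
  apply real_Lub_le; [|apply unit_ball_image_nonempty].
  intros r [x [Hx ->]]. apply Rnot_lt_le. intros Hlt.
  apply Hno. now exists x.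
Qed.

End OperatorNorm.

(** * The uniform boundedness principle *)

Section GlidingHump.

Context {V : NormedModule R_AbsRing}.

(** The vector [2 d] is the difference of [x + d] and [x - d]. Hence, wherever
    [x] lies, one of the two points has an image as large as that of [d]. *)
Lemma norm_linear_le_max (L : V -> V) (x d : V) : is_linear L ->
  norm (L d) <= Rmax (norm (L (plus x d))) (norm (L (minus x d))).
Proof.
  intros HL.
  assert (E : scal 2 (L d) = minus (L (plus x d)) (L (minus x d))).
  { rewrite (linear_plus L HL), (linear_minus L x d HL). module_eq. }
  assert (H : 2 * norm (L d) <= norm (L (plus x d)) + norm (L (minus x d))).
  { rewrite <- (Rabs_right 2) by lra. rewrite <- norm_scal_real, E.
    apply norm_minus_le. }
  unfold Rmax; destruct (Rle_dec _ _); lra.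
Qed.

(** With [u n] in the unit ball, step [n] has length at most [3 ^ (- n)]. It is
    taken in the direction, of the two available, that makes the image under
    [L n] large. The steps shrink so fast that all later ones together cannot
    undo this gain. *)
Fixpoint gliding_hump (L : nat -> V -> V) (u : nat -> V) (n : nat) : V :=
  match n with
  | O => zero
  | S m =>
      let x := gliding_hump L u m in
      let d := scal ((/ 3) ^ m) (u m) in
      if Rle_dec (norm (L m (minus x d))) (norm (L m (plus x d)))
      then plus x d else minus x d
  end.

Lemma pow_third_pos (n : nat) : 0 < (/ 3) ^ n.
Proof. apply pow_lt; lra. Qed.

Lemma gliding_hump_step (L : nat -> V -> V) (u : nat -> V) (n : nat) :
  norm (u n) <= 1 ->
  norm (minus (gliding_hump L u (S n)) (gliding_hump L u n)) <= (/ 3) ^ n.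
Proof.
  intros Hu. pose proof (pow_third_pos n) as Hp.
  assert (Hd : norm (scal ((/ 3) ^ n) (u n)) <= (/ 3) ^ n).
  { rewrite norm_scal_real, Rabs_right by lra. nra. }
  simpl gliding_hump. set (x := gliding_hump L u n) in *.
  set (d := scal ((/ 3) ^ n) (u n)) in *.
  destruct (Rle_dec _ _).
  - replace (minus (plus x d) x) with d by module_eq. exact Hd.
  - replace (minus (minus x d) x) with (opp d) by module_eq.
    rewrite (norm_opp d : norm (opp d) = norm d). exact Hd.
Qed.

Lemma gliding_hump_large (L : nat -> V -> V) (u : nat -> V) (n : nat) :
  is_linear (L n) ->
  (/ 3) ^ n * norm (L n (u n)) <= norm (L n (gliding_hump L u (S n))).
Proof.
  intros HL. pose proof (pow_third_pos n) as Hp.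
  rewrite <- (Rabs_right ((/ 3) ^ n)) by lra.
  rewrite <- norm_scal_real, <- (linear_scal (L n) HL).
  set (d := scal ((/ 3) ^ n) (u n)).
  apply Rle_trans with (1 := norm_linear_le_max (L n) (gliding_hump L u n) d HL).
  simpl gliding_hump. fold d. unfold Rmax.
  repeat destruct (Rle_dec _ _); lra.
Qed.

Lemma gliding_hump_dist (L : nat -> V -> V) (u : nat -> V) (n m : nat) :
  (forall n, norm (u n) <= 1) ->
  norm (minus (gliding_hump L u (n + m)) (gliding_hump L u n))
    <= 3 / 2 * (/ 3) ^ n.
Proof.
  intros Hu.
  (* Keeping the remainder of the geometric series makes the bound inductive. *)
  enough (H : norm (minus (gliding_hump L u (n + m)) (gliding_hump L u n))
    <= 3 / 2 * ((/ 3) ^ n - (/ 3) ^ (n + m))).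
  { pose proof (pow_third_pos (n + m)). lra. }
  induction m as [|m IH].
  - rewrite Nat.add_0_r, norm_minus_diag. lra.
  - rewrite Nat.add_succ_r.
    pose proof (gliding_hump_step L u (n + m) (Hu _)) as Hs.
    apply Rle_trans with (1 := norm_minus_triangle _ (gliding_hump L u (n + m)) _).
    simpl pow. lra.
Qed.

End GlidingHump.

Section UniformBoundedness.

Context {V : CompleteNormedModule R_AbsRing}.

Lemma gliding_hump_limit (L : nat -> V -> V) (u : nat -> V) :
  (forall n, norm (u n) <= 1) ->
  exists x, forall n, norm (minus x (gliding_hump L u n)) <= 3 / 2 * (/ 3) ^ n.
Proof.
  intros Hu.
  assert (Hc : exists x, filterlim (gliding_hump L u) eventually (locally x)).
  { apply (filterlim_locally_cauchy (U := V) (F := eventually)). intros e.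
    destruct (pow_lt_1_zero (/ 3) ltac:(rewrite Rabs_right; lra) (e / 4))
      as [N HN].
    { pose proof (cond_pos e); lra. }
    exists (fun n => (N <= n)%nat). split; [now exists N|].
    assert (Hclose : forall p, (N <= p)%nat ->
      norm (minus (gliding_hump L u p) (gliding_hump L u N)) < 3 / 2 * (e / 4)).
    { intros p Hp. replace p with (N + (p - N))%nat by lia.
      apply Rle_lt_trans with (1 := gliding_hump_dist L u N (p - N) Hu).
      specialize (HN N (le_n N)). rewrite Rabs_right in HN; [lra|].
      apply Rle_ge, Rlt_le, pow_third_pos. }
    intros p q Hp Hq. apply (norm_compat1 (V := V)).
    change (norm (minus (gliding_hump L u q) (gliding_hump L u p)) < e).
    pose proof (Hclose p Hp). pose proof (Hclose q Hq).
    apply Rle_lt_trans with (1 := norm_minus_triangle _ (gliding_hump L u N) _).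
    rewrite (norm_minus_sym (gliding_hump L u N)).
    pose proof (cond_pos e); lra. }
  destruct Hc as [x Hx]. exists x. intros n. apply le_epsilon. intros e He.
  destruct (proj1 (filterlim_norm_iff (gliding_hump L u) x) Hx e He) as [N HN].
  specialize (HN (n + N)%nat ltac:(lia)). rewrite norm_minus_sym in HN.
  pose proof (gliding_hump_dist L u n N Hu).
  apply Rle_trans with (1 := norm_minus_triangle _ (gliding_hump L u (n + N)) _).
  lra.
Qed.

(** Otherwise there are operators [L n] in the family of norm above [4 ^ n], and
    points [u n] of the unit ball that nearly attain these norms. The limit [x] of the
    gliding hump satisfies [norm (L n x) >= operator_norm (L n) * 3 ^ (- n) / 6],
    which exceeds [(4 / 3) ^ n / 6] and contradicts the bound at [x]. *)
Theorem uniform_boundedness (P : (V -> V) -> Prop) :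
  (forall L, P L -> is_linear L) ->
  (forall x, exists M, forall L, P L -> norm (L x) <= M) ->
  exists M, forall L x, P L -> norm (L x) <= M * norm x.
Proof.
  intros Hlin Hpt. apply NNPP. intros Hno.
  assert (Hseq : forall n : nat, exists p : (V -> V) * V,
    P (fst p) /\ 4 ^ n < operator_norm (fst p) /\ norm (snd p) <= 1 /\
    2 / 3 * operator_norm (fst p) < norm (fst p (snd p))).
  { intros n. assert (H4 : 0 < 4 ^ n) by (apply pow_lt; lra).
    destruct (not_all_ex_not _ _ (not_ex_all_not _ _ Hno (4 ^ n))) as [L HL].
    apply not_all_ex_not in HL. destruct HL as [x Hx].
    apply imply_to_and in Hx. destruct Hx as [HP Hx]. apply Rnot_le_lt in Hx.
    pose proof (operator_norm_bound L (Hlin L HP) x) as Hb.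
    pose proof (norm_ge_0 x) as Hx0.
    assert (Hbig : 4 ^ n < operator_norm L).
    { apply Rnot_le_lt; intros Hle. nra. }
    (* Any fraction above 1/2 works: the tail of the hump takes away at most
       half of [operator_norm L * 3 ^ (- n)]. *)
    destruct (operator_norm_nearly_attained L (2 / 3 * operator_norm L))
      as [y [Hy1 Hy2]]; [lra|].
    now exists (L, y). }
  apply functional_choice in Hseq. destruct Hseq as [p Hp].
  set (L := fun n => fst (p n)). set (u := fun n => snd (p n)).
  destruct (gliding_hump_limit L u) as [x Hx]; [intros n; apply Hp|].
  destruct (Hpt x) as [M HM].
  destruct (Pow_x_infinity (4 / 3) ltac:(rewrite Rabs_right; lra) (6 * M + 1))
    as [n Hn].
  specialize (Hn n (le_n n)).
  rewrite Rabs_right in Hn by (apply Rle_ge, pow_le; lra).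
  destruct (Hp n) as [HP [Hbig [Hu1 Hu2]]].
  fold (L n) in HP, Hbig, Hu2. fold (u n) in Hu1, Hu2.
  pose proof (gliding_hump_large L u n (Hlin _ HP)) as Hlarge.
  pose proof (operator_norm_bound (L n) (Hlin _ HP)
    (minus x (gliding_hump L u (S n)))) as Htail.
  specialize (Hx (S n)). specialize (HM _ HP).
  rewrite (linear_minus (L n) _ _ (Hlin _ HP)), norm_minus_sym in Htail.
  pose proof (norm_le_minus (L n (gliding_hump L u (S n))) (L n x)) as Htri.
  simpl pow in Hx.
  pose proof (pow_third_pos n) as H3.
  assert (H43 : (4 / 3) ^ n = 4 ^ n * (/ 3) ^ n)
    by (unfold Rdiv; apply Rpow_mult_distr).
  assert (H4 : 0 < 4 ^ n) by (apply pow_lt; lra).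
  set (K := operator_norm (L n)) in *.
  assert (Ht2 : norm (minus (L n (gliding_hump L u (S n))) (L n x))
    <= K * (/ 3) ^ n / 2) by nra.
  assert (Hl2 : (/ 3) ^ n * (2 / 3 * K) <= (/ 3) ^ n * norm (L n (u n))) by nra.
  assert (H4K : 4 ^ n * (/ 3) ^ n <= K * (/ 3) ^ n) by nra.
  normed_structures. lra.
Qed.

End UniformBoundedness.

(** * Strongly continuous semigroups *)

(** The real-linear counterpart of a strongly continuous semigroup, so that the
    theory applies to spaces over either field after restriction of scalars. *)
Record semigroup {V : NormedModule R_AbsRing} (T : R -> V -> V) : Prop := {
  sg_linear : forall t, 0 <= t -> is_linear (T t);
  sg_zero : forall x, T 0 x = x;
  sg_plus : forall t s x, 0 <= t -> 0 <= s -> T (t + s) x = T t (T s x);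
  sg_right_cont : forall x, filterlim (fun t => T t x) (at_right 0) (locally x)
}.

(** Extending the orbit by a constant to negative times makes it continuous on
    the whole line, the setting in which it can be integrated and composed
    without side conditions. *)
Definition orbit {V : NormedModule R_AbsRing} (T : R -> V -> V) (x : V) (t : R) : V :=
  T (Rmax 0 t) x.

Lemma orbit_nonneg {V : NormedModule R_AbsRing} (T : R -> V -> V) (x : V) (t : R) :
  0 <= t -> orbit T x t = T t x.
Proof. intros Ht. unfold orbit. now rewrite Rmax_right. Qed.

(** [x] is in the domain of the generator of [T], with value [y]. *)
Definition generator_value {V : NormedModule R_AbsRing} (T : R -> V -> V) (x y : V) :=
  filterlim (fun h => scal (/ h) (minus (T h x) x)) (at_right 0) (locally y).

Section Semigroups.

Context {V : CompleteNormedModule R_AbsRing} (T : R -> V -> V).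
Hypothesis HT : semigroup T.

(** If this failed, there would be times [t n] tending to zero along which the
    operators [T (t n)] are unbounded; but each orbit converges along these
    times, which the uniform boundedness principle forbids. *)
Lemma semigroup_bounded_near_zero :
  exists d M, 0 < d /\ 1 <= M /\
    forall t x, 0 <= t <= d -> norm (T t x) <= M * norm x.
Proof.
  apply NNPP. intros Hno.
  assert (Hseq : forall n : nat, exists t, 0 <= t <= / (INR n + 1) /\
    exists x, (INR n + 1) * norm x < norm (T t x)).
  { intros n. apply NNPP. intros Hn. apply Hno.
    pose proof (pos_INR n) as Hpos.
    exists (/ (INR n + 1)), (INR n + 1). split; [apply Rinv_0_lt_compat; lra|].
    split; [lra|].
    intros t x Ht. apply Rnot_lt_le. intros Hlt. apply Hn.
    exists t; split; [exact Ht|now exists x]. }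
  apply functional_choice in Hseq. destruct Hseq as [t Ht].
  destruct (uniform_boundedness (fun L => exists n, L = T (t n))) as [M HM].
  - intros L [n ->]. apply (sg_linear T HT), Ht.
  - intros x.
    destruct (filterlim_bounded (fun n => T (t n) x)) as [M HM].
    + exists x. apply filterlim_norm_iff. intros e He.
      destruct (proj1 (right_limit_iff _ _) (sg_right_cont T HT x) e He)
        as [d [Hd Hlim]].
      destruct (archimed_cor1 d Hd) as [N [HN HN0]].
      exists N. intros n Hn. destruct (Ht n) as [Htn _].
      destruct (Req_dec (t n) 0) as [->|H0].
      * rewrite (sg_zero T HT), norm_minus_diag. exact He.
      * apply Hlim. split; [lra|].
        apply Rle_lt_trans with (2 := HN).
        apply Rle_trans with (1 := proj2 Htn). apply le_INR in Hn.
        apply lt_INR in HN0. simpl in HN0. apply Rinv_le_contravar; lra.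
    + exists M. intros L [n ->]. apply HM.
  - destruct (nfloor_ex (Rmax 0 M) (Rmax_l _ _)) as [n [_ Hn]].
    destruct (Ht n) as [_ [x Hx]].
    specialize (HM _ x (ex_intro _ n eq_refl)).
    pose proof (Rmax_r 0 M). pose proof (norm_ge_0 x). nra.
Qed.

Lemma semigroup_locally_bounded (b : R) :
  exists M, 1 <= M /\ forall t x, 0 <= t <= b -> norm (T t x) <= M * norm x.
Proof.
  destruct semigroup_bounded_near_zero as [d [M [Hd [HM1 HM]]]].
  assert (Hn : forall n : nat, exists K, 1 <= K /\
    forall t x, 0 <= t <= INR n * d -> norm (T t x) <= K * norm x).
  { induction n as [|n [K [HK1 HK]]].
    - exists 1. split; [lra|]. intros t x Ht. simpl in Ht.
      replace t with 0 by lra. rewrite (sg_zero T HT). lra.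
    - exists (M * K). split; [nra|]. intros t x Ht. rewrite S_INR in Ht.
      pose proof (norm_ge_0 x) as Hx. pose proof (pos_INR n) as Hn.
      destruct (Rle_dec t d) as [Htd|Htd].
      + apply Rle_trans with (1 := HM t x ltac:(lra)).
        apply Rmult_le_compat_r; nra.
      + replace t with (d + (t - d)) by ring.
        rewrite (sg_plus T HT) by lra.
        apply Rle_trans with (1 := HM d _ ltac:(lra)).
        rewrite Rmult_assoc. apply Rmult_le_compat_l; [lra|].
        apply HK. lra. }
  destruct (nfloor_ex (Rmax 0 (b / d)) (Rmax_l _ _)) as [n [_ Hb]].
  destruct (Hn (S n)) as [K [HK1 HK]].
  exists K. split; [exact HK1|]. intros t x Ht. apply HK.
  rewrite S_INR. pose proof (Rmax_r 0 (b / d)).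
  assert (b / d * d = b) by (field; lra). nra.
Qed.

(** Right continuity at zero propagates: two values of the orbit at times
    [p <= q] differ by the image under [T p] of a difference at times [0] and
    [q - p], and the operators are bounded on bounded time intervals. *)
Lemma orbit_continuous (x : V) (s : R) : continuous (orbit T x) s.
Proof.
  apply continuous_norm_iff. intros e He.
  destruct (semigroup_locally_bounded (Rmax 0 s + 1)) as [M [HM1 HM]].
  assert (HeM : 0 < e / M) by (apply Rdiv_lt_0_compat; lra).
  destruct (proj1 (right_limit_iff _ _) (sg_right_cont T HT x) (e / M) HeM)
    as [d [Hd Hlim]].
  exists (Rmin d 1). split; [apply Rmin_pos; lra|]. intros r Hr. unfold orbit.
  assert (Hrs : Rabs (Rmax 0 r - Rmax 0 s) < Rmin d 1).
  { apply Rle_lt_trans with (2 := Hr).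
    unfold Rmax, Rabs; repeat destruct (Rle_dec _ _); repeat destruct (Rcase_abs _); lra. }
  pose proof (Rmax_l 0 r) as Hr0. pose proof (Rmax_l 0 s) as Hs0.
  revert Hrs HM Hr0 Hs0.
  generalize (Rmax 0 r) (Rmax 0 s). clear s r Hr. intros r s Hr HM Hr0 Hs0.
  assert (Hwlog : forall p q, 0 <= p <= s + 1 -> p <= q < p + d ->
    norm (minus (T q x) (T p x)) < e).
  { intros p q Hp Hq. replace q with (p + (q - p)) by ring.
    destruct (Req_dec q p) as [->|Hqp].
    - replace (p + (p - p)) with p by ring.
      normed_structures. now rewrite norm_minus_diag.
    - rewrite (sg_plus T HT) by lra.
      rewrite <- (linear_minus (T p) _ _ (sg_linear T HT p (proj1 Hp))).
      apply Rle_lt_trans with (1 := HM p _ Hp).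
      specialize (Hlim (q - p) ltac:(lra)).
      apply Rlt_le_trans with (M * (e / M)).
      + apply Rmult_lt_compat_l; [lra|exact Hlim].
      + right; field; lra. }
  apply Rabs_def2 in Hr. pose proof (Rmin_l d 1). pose proof (Rmin_r d 1).
  destruct (Rle_dec s r).
  - apply Hwlog; lra.
  - rewrite norm_minus_sym. apply Hwlog; lra.
Qed.

Lemma orbit_ex_RInt (x : V) (a b : R) : ex_RInt (orbit T x) a b.
Proof. apply (ex_RInt_continuous (V := V)). intros s _. apply orbit_continuous. Qed.

End Semigroups.

Section Integrals.

Context {V : CompleteNormedModule R_AbsRing}.

Lemma RInt_right_derivative (f : R -> V) (s : R) :
  (forall r, continuous f r) ->
  filterlim (fun h => scal (/ h) (RInt f s (s + h))) (at_right 0) (locally (f s)).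
Proof.
  intros Hf. apply (right_limit_iff (V := V)). intros e He.
  destruct (proj1 (continuous_norm_iff f s) (Hf s) (e / 2) ltac:(lra))
    as [d [Hd Hclose]].
  exists d. split; [exact Hd|]. intros h Hh.
  assert (Hint : is_RInt (fun r => minus (f r) (f s)) s (s + h)
    (minus (RInt f s (s + h)) (scal h (f s)))).
  { apply (is_RInt_minus (V := V)).
    - apply (RInt_correct (V := V)), (ex_RInt_continuous (V := V)). intros; apply Hf.
    - replace h with (s + h - s) at 2 by ring. apply (is_RInt_const (V := V)). }
  apply (norm_RInt_le_const _ _ _ _ (e / 2)) in Hint; [|lra|].
  - normed_structures. rewrite norm_difference_quotient by lra.
    apply Rle_lt_trans with (/ h * ((s + h - s) * (e / 2))).
    + apply Rmult_le_compat_l; [apply Rlt_le, Rinv_0_lt_compat; lra|exact Hint].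
    + replace (/ h * ((s + h - s) * (e / 2))) with (e / 2) by (field; lra). lra.
  - intros r Hr. apply Rlt_le, Hclose. rewrite Rabs_right; lra.
Qed.

(** Both sides are primitives of the same continuous function. *)
Lemma RInt_linear (L : V -> V) (f : R -> V) (a b : R) :
  is_linear L -> (forall r, continuous f r) ->
  RInt (fun r => L (f r)) a b = L (RInt f a b).
Proof.
  intros HL Hf. apply (is_RInt_unique (V := V)).
  replace (L (RInt f a b)) with (minus (L (RInt f a b)) (L (RInt f a a))).
  - apply (is_RInt_derive (V := V) (fun s => L (RInt f a s)) (fun r => L (f r))).
    + intros s _.
      apply filterdiff_ext_lin with (fun y => L (scal y (f s))).
      * apply (filterdiff_comp' (fun s => RInt f a s) L s (fun y => scal y (f s)) L).
        -- apply (is_derive_RInt (V := V) f (fun s => RInt f a s) a s); [|apply Hf].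
           apply filter_forall. intros r.
           apply (RInt_correct (V := V)), (ex_RInt_continuous (V := V)). intros; apply Hf.
        -- now apply filterdiff_linear.
      * intros y. apply (linear_scal L HL).
    + intros s _. apply (continuous_comp f L); [apply Hf|].
      exact (linear_cont (U := V) (V := V) L (f s) HL).
  - rewrite RInt_point. rewrite (linear_zero L HL : L zero = zero).
    module_eq.
Qed.

End Integrals.

(** * A differential inequality for right difference quotients *)

Section DifferentialInequalities.

Lemma continuous_real_iff (f : R -> R) (s : R) :
  continuous f s <->
  forall e, 0 < e -> exists d, 0 < d /\
    forall r, Rabs (r - s) < d -> Rabs (f r - f s) < e.
Proof. exact (continuous_norm_iff (V := R_NormedModule) f s). Qed.

(** Let [m] be the supremum of the times up to which [psi] is nonpositive.
    If [m < b], the right neighbourhood of [m] extends this interval: by local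
    decrease if [a < m], and because [psi a] is strictly negative if [m = a].
    The second case is what allows the local condition to fail at [a]. *)
Lemma nonpositive_of_local_decrease (psi : R -> R) (a b : R) :
  a <= b -> (forall s, continuous psi s) -> psi a < 0 ->
  (forall s, a < s < b -> exists d, 0 < d /\
    forall h, 0 < h < d -> psi (s + h) <= psi s) ->
  psi b <= 0.
Proof.
  intros Hab Hcont Ha Hdec.
  set (E := fun s => a <= s <= b /\ forall r, a <= r <= s -> psi r <= 0).
  destruct (completeness E) as [m [Hub Hleast]].
  { exists b. intros s [Hs _]. lra. }
  { exists a. split; [lra|]. intros r Hr. replace r with a by lra. lra. }
  assert (Ham : a <= m).
  { apply Hub. split; [lra|]. intros r Hr. replace r with a by lra. lra. }
  assert (Hmb : m <= b) by (apply Hleast; intros s [Hs _]; lra).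
  assert (Hbelow : forall r, a <= r < m -> psi r <= 0).
  { intros r Hr. apply NNPP. intros Hpos. apply (Rlt_not_le _ _ (proj2 Hr)).
    apply Hleast. intros s [Hs1 Hs2]. apply Rnot_lt_le. intros Hlt.
    apply Hpos, Hs2. lra. }
  assert (Hm : psi m <= 0).
  { apply Rnot_lt_le. intros Hpos.
    destruct (proj1 (continuous_real_iff psi m) (Hcont m) (psi m) Hpos)
      as [d [Hd Hclose]].
    destruct (Rle_lt_or_eq_dec a m Ham) as [Hlt|Heq]; [|rewrite Heq in Ha; lra].
    set (r := Rmax a (m - d / 2)).
    assert (Hr : a <= r < m /\ m - r < d)
      by (unfold r, Rmax; destruct (Rle_dec _ _); lra).
    specialize (Hclose r ltac:(rewrite Rabs_left; lra)).
    specialize (Hbelow r (proj1 Hr)). apply Rabs_def2 in Hclose. lra. }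
  assert (Hext : m < b -> exists d, 0 < d /\ forall h, 0 < h < d -> psi (m + h) <= 0).
  { intros Hlt. destruct (Rle_lt_or_eq_dec a m Ham) as [Ham'|Heq].
    - destruct (Hdec m ltac:(lra)) as [d [Hd H]]. exists d. split; [exact Hd|].
      intros h Hh. specialize (H h Hh). lra.
    - destruct (proj1 (continuous_real_iff psi m) (Hcont m) (- psi a) ltac:(lra))
        as [d [Hd Hclose]].
      exists d. split; [exact Hd|]. intros h Hh.
      specialize (Hclose (m + h) ltac:(rewrite Rabs_right; lra)).
      rewrite <- Heq in Hclose at 2. apply Rabs_def2 in Hclose. lra. }
  destruct (Rle_lt_or_eq_dec m b Hmb) as [Hlt|Heq]; [|rewrite <- Heq; exact Hm].
  exfalso. destruct (Hext Hlt) as [d [Hd H]].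
  set (h := Rmin (d / 2) (b - m)).
  assert (Hh : 0 < h < d /\ m + h <= b)
    by (unfold h, Rmin; destruct (Rle_dec _ _); lra).
  assert (m + h <= m); [|lra].
  apply Hub. split; [lra|]. intros r Hr.
  destruct (Rtotal_order r m) as [H1|[->|H1]].
  - apply Hbelow; lra.
  - exact Hm.
  - replace r with (m + (r - m)) by ring. apply H. lra.
Qed.

(** A slope [eta] and an offset [eta] make room for the slack in the difference
    quotients and for the missing condition at [a]. *)
Lemma right_derivative_nonpos (phi : R -> R) (a b : R) :
  a <= b -> (forall s, continuous phi s) ->
  (forall s, a < s < b -> forall e, 0 < e -> exists d, 0 < d /\
    forall h, 0 < h < d -> phi (s + h) <= phi s + e * h) ->
  phi b <= phi a.
Proof.
  intros Hab Hcont Hder. apply le_epsilon. intros e He.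
  set (eta := e / (1 + (b - a))).
  assert (Heta : 0 < eta) by (apply Rdiv_lt_0_compat; lra).
  assert (Hsum : eta * (1 + (b - a)) = e) by (unfold eta; field; lra).
  enough (H : phi b - phi a - eta * (1 + (b - a)) <= 0) by lra.
  apply (nonpositive_of_local_decrease
    (fun s => phi s - phi a - eta * (1 + (s - a))) a b Hab).
  - intros s. apply (continuous_minus (V := R_NormedModule)).
    + apply (continuous_minus (V := R_NormedModule)); [apply Hcont|apply continuous_const].
    + apply (ex_derive_continuous (V := R_NormedModule)). auto_derive. exact I.
  - lra.
  - intros s Hs. destruct (Hder s Hs eta Heta) as [d [Hd H]].
    exists d. split; [exact Hd|]. intros h Hh. specialize (H h Hh). lra.
Qed.

Lemma exp_le_mono (x y : R) : x <= y -> exp x <= exp y.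
Proof. intros [H| ->]; [left; now apply exp_increasing|right; reflexivity]. Qed.

(** Only right difference quotients at interior points are controlled, since
    generators of semigroups are right derivatives and the bound on the
    right-hand side may change at the endpoints. The function
    [exp (gamma s) * (g s - K / gamma)] then has nonpositive right derivative. *)
Lemma right_gronwall (g : R -> R) (gamma K a b : R) :
  0 < gamma -> 0 <= K -> a <= b -> (forall s, continuous g s) ->
  (forall s, a < s < b -> forall e, 0 < e -> exists d, 0 < d /\
    forall h, 0 < h < d -> g (s + h) <= exp (- gamma * h) * g s + (K + e) * h) ->
  exp (gamma * b) * g b
    <= exp (gamma * a) * g a + K / gamma * (exp (gamma * b) - exp (gamma * a)).
Proof.
  intros Hgamma HK Hab Hcont Hder.
  enough (H : exp (gamma * b) * (g b - K / gamma)
    <= exp (gamma * a) * (g a - K / gamma)) by lra.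
  apply (right_derivative_nonpos (fun s => exp (gamma * s) * (g s - K / gamma)) a b Hab).
  - intros s. apply (continuous_mult (K := R_AbsRing)).
    + apply (ex_derive_continuous (V := R_NormedModule)). auto_derive. exact I.
    + apply (continuous_minus (V := R_NormedModule)); [apply Hcont|apply continuous_const].
  - intros s Hs e He.
    set (E := exp (gamma * s)). assert (HE : 0 < E) by apply exp_pos.
    (* e is shared between the slack of the derivative bound and the excess of
       exp (gamma h) over 1 *)
    set (e1 := e / (4 * E)).
    assert (He1 : 0 < e1) by (apply Rdiv_lt_0_compat; lra).
    set (e2 := Rmin 1 (e / (2 * E * (K + 1)))).
    assert (He2 : 0 < e2 <= 1).
    { unfold e2. split; [|apply Rmin_l]. apply Rmin_pos; [lra|].
      apply Rdiv_lt_0_compat; nra. }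
    assert (He2' : e2 * (E * (K + 1)) <= e / 2).
    { apply Rle_trans with (e / (2 * E * (K + 1)) * (E * (K + 1))).
      - apply Rmult_le_compat_r; [nra|apply Rmin_r].
      - right; field; lra. }
    assert (He1' : e1 * E = e / 4) by (unfold e1; field; lra).
    destruct (Hder s Hs e1 He1) as [d1 [Hd1 H1]].
    assert (Hexp : continuous (fun h => exp (gamma * h)) 0).
    { apply (ex_derive_continuous (V := R_NormedModule)). auto_derive. exact I. }
    destruct (proj1 (continuous_real_iff _ 0) Hexp e2 (proj1 He2)) as [d2 [Hd2 H2]].
    exists (Rmin d1 d2). split; [now apply Rmin_pos|]. intros h Hh.
    pose proof (Rmin_l d1 d2). pose proof (Rmin_r d1 d2).
    specialize (H1 h ltac:(lra)).
    specialize (H2 h ltac:(rewrite Rminus_0_r, Rabs_right; lra)).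
    rewrite Rmult_0_r, exp_0 in H2. apply Rabs_def2 in H2.
    pose proof (exp_ineq1_le (gamma * h)) as Hineq.
    assert (Hinv : exp (gamma * h) * exp (- gamma * h) = 1).
    { rewrite <- exp_plus, <- exp_0. f_equal. ring. }
    replace (gamma * (s + h)) with (gamma * s + gamma * h) by ring.
    rewrite exp_plus. fold E. set (G := exp (gamma * h)) in *.
    assert (HG : 1 < G < 2) by (assert (0 < gamma * h) by nra; lra).
    assert (Hstep : G * g (s + h) <= g s + G * ((K + e1) * h)).
    { apply Rle_trans with (G * (exp (- gamma * h) * g s + (K + e1) * h)).
      - apply Rmult_le_compat_l; lra.
      - right. rewrite Rmult_plus_distr_l, <- Rmult_assoc, Hinv. ring. }
    assert (HKG : K * h <= K / gamma * (G - 1)).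
    { replace (K * h) with (K / gamma * (gamma * h)) by (field; lra).
      apply Rmult_le_compat_l; [|lra].
      apply Rmult_le_pos; [lra|]. now apply Rlt_le, Rinv_0_lt_compat. }
    assert (Hmain : G * (g (s + h) - K / gamma)
      <= (g s - K / gamma) + ((G - 1) * K + G * e1) * h) by lra.
    assert (Hslack : ((G - 1) * K + G * e1) * E <= e).
    { assert ((G - 1) * (E * K) <= e2 * (E * (K + 1))).
      { apply Rmult_le_compat; nra. }
      assert (G * (e1 * E) <= 2 * (e / 4)) by nra.
      lra. }
    rewrite Rmult_assoc.
    apply Rle_trans with (E * ((g s - K / gamma) + ((G - 1) * K + G * e1) * h)).
    + apply Rmult_le_compat_l; lra.
    + rewrite Rmult_plus_distr_l. apply Rplus_le_compat_l.
      replace (E * (((G - 1) * K + G * e1) * h))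
        with (((G - 1) * K + G * e1) * E * h) by ring.
      apply Rmult_le_compat_r; lra.
Qed.

End DifferentialInequalities.

(** * An equivalent norm in which the decay has no constant *)

Section DecayNorm.

Context {V : NormedModule R_AbsRing} (S : R -> V -> V) (Gamma gamma : R).
Hypothesis HS : semigroup S.
Hypothesis Hdecay :
  forall t x, 0 <= t -> norm (S t x) <= Gamma * exp (- gamma * t) * norm x.

(** The factor [Gamma] would accumulate over successive intervals between
    events; in this equivalent norm the semigroup decays with factor one, see
    [decay_norm_semigroup]. *)
Definition decay_norm (x : V) : R :=
  real (Lub_Rbar (fun r => exists t, 0 <= t /\ r = exp (gamma * t) * norm (S t x))).

Lemma decay_orbit_bound (x : V) (t : R) : 0 <= t ->
  exp (gamma * t) * norm (S t x) <= Gamma * norm x.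
Proof.
  intros Ht.
  apply Rle_trans with (exp (gamma * t) * (Gamma * exp (- gamma * t) * norm x)).
  - apply Rmult_le_compat_l; [apply Rlt_le, exp_pos|now apply Hdecay].
  - right.
    replace (exp (gamma * t) * (Gamma * exp (- gamma * t) * norm x))
      with (exp (gamma * t) * exp (- gamma * t) * (Gamma * norm x)) by ring.
    rewrite <- exp_plus. replace (gamma * t + - gamma * t) with 0 by ring.
    rewrite exp_0. ring.
Qed.

Lemma decay_norm_ge (x : V) (t : R) : 0 <= t ->
  exp (gamma * t) * norm (S t x) <= decay_norm x.
Proof.
  intros Ht. apply (real_Lub_ge _ (Gamma * norm x)); [|now exists t].
  intros r [q [Hq ->]]. now apply decay_orbit_bound.
Qed.

Lemma decay_norm_le (x : V) (C : R) :
  (forall t, 0 <= t -> exp (gamma * t) * norm (S t x) <= C) -> decay_norm x <= C.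
Proof.
  intros HC. apply real_Lub_le.
  - intros r [q [Hq ->]]. now apply HC.
  - exists (exp (gamma * 0) * norm (S 0 x)), 0. split; [lra|reflexivity].
Qed.

Lemma norm_le_decay_norm (x : V) : norm x <= decay_norm x.
Proof.
  pose proof (decay_norm_ge x 0 (Rle_refl 0)) as H.
  rewrite Rmult_0_r, exp_0, (sg_zero S HS) in H. lra.
Qed.

Lemma decay_norm_le_norm (x : V) : decay_norm x <= Gamma * norm x.
Proof. apply decay_norm_le. intros t. apply decay_orbit_bound. Qed.

Lemma decay_norm_plus (x y : V) :
  decay_norm (plus x y) <= decay_norm x + decay_norm y.
Proof.
  apply decay_norm_le. intros t Ht.
  rewrite (linear_plus (S t) (sg_linear S HS t Ht)).
  pose proof (decay_norm_ge x t Ht). pose proof (decay_norm_ge y t Ht).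
  apply Rle_trans with (exp (gamma * t) * (norm (S t x) + norm (S t y))); [|lra].
  apply Rmult_le_compat_l; [apply Rlt_le, exp_pos|apply norm_triangle].
Qed.

Lemma decay_norm_semigroup (x : V) (h : R) : 0 <= h ->
  decay_norm (S h x) <= exp (- gamma * h) * decay_norm x.
Proof.
  intros Hh. apply decay_norm_le. intros t Ht.
  rewrite <- (sg_plus S HS) by assumption.
  replace (gamma * t) with (- gamma * h + gamma * (t + h)) by ring.
  rewrite exp_plus, Rmult_assoc.
  apply Rmult_le_compat_l; [apply Rlt_le, exp_pos|apply decay_norm_ge; lra].
Qed.

Lemma decay_norm_perturb (x y : V) :
  decay_norm x <= decay_norm y + Gamma * norm (minus x y).
Proof.
  replace x with (plus y (minus x y)) at 1 by module_eq.
  apply Rle_trans with (1 := decay_norm_plus _ _).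
  apply Rplus_le_compat_l, decay_norm_le_norm.
Qed.

Lemma decay_norm_continuous (f : R -> V) (s : R) : 1 <= Gamma ->
  continuous f s -> continuous (fun r => decay_norm (f r)) s.
Proof.
  intros HG Hf. apply continuous_real_iff. intros e He.
  destruct (proj1 (continuous_norm_iff f s) Hf (e / Gamma)) as [d [Hd Hclose]].
  { apply Rdiv_lt_0_compat; lra. }
  exists d. split; [exact Hd|]. intros r Hr. specialize (Hclose r Hr).
  pose proof (decay_norm_perturb (f r) (f s)) as H1.
  pose proof (decay_norm_perturb (f s) (f r)) as H2.
  rewrite (norm_minus_sym (f s)) in H2.
  assert (Hlt : Gamma * norm (minus (f r) (f s)) < Gamma * (e / Gamma))
    by (apply Rmult_lt_compat_l; lra).
  replace (Gamma * (e / Gamma)) with e in Hlt by (field; lra).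
  apply Rabs_def1; lra.
Qed.

End DecayNorm.

(** * Generators and the state under a constant input *)

Section Generators.

Context {V : NormedModule R_AbsRing} (T : R -> V -> V).
Hypothesis HT : semigroup T.

Lemma generator_value_iff (x y : V) :
  generator_value T x y <->
  forall e, 0 < e -> exists d, 0 < d /\ forall h, 0 < h < d ->
    norm (minus (minus (T h x) x) (scal h y)) <= e * h.
Proof.
  pose proof (right_limit_iff (V := V) (fun h => scal (/ h) (minus (T h x) x)) y)
    as Hiff.
  split; [intros H e He|intros H; apply Hiff; intros e He].
  - destruct (proj1 Hiff H e He) as [d [Hd Hlim]]. exists d. split; [exact Hd|].
    intros h Hh. specialize (Hlim h Hh). normed_structures.
    rewrite norm_difference_quotient in Hlim by lra.
    set (X := norm _) in *.
    replace X with (/ h * X * h) by (field; lra). nra.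
  - destruct (H (e / 2) ltac:(lra)) as [d [Hd Hlim]]. exists d. split; [exact Hd|].
    intros h Hh. specialize (Hlim h Hh). normed_structures.
    rewrite norm_difference_quotient by lra.
    apply Rle_lt_trans with (/ h * (e / 2 * h)).
    + apply Rmult_le_compat_l; [apply Rlt_le, Rinv_0_lt_compat|]; tauto.
    + replace (/ h * (e / 2 * h)) with (e / 2) by (field; lra). lra.
Qed.

Lemma generator_value_plus (x y x' y' : V) :
  generator_value T x y -> generator_value T x' y' ->
  generator_value T (plus x x') (plus y y').
Proof.
  rewrite !generator_value_iff. intros H H' e He.
  destruct (H (e / 2) ltac:(lra)) as [d [Hd Hx]].
  destruct (H' (e / 2) ltac:(lra)) as [d' [Hd' Hx']].
  exists (Rmin d d'). split; [now apply Rmin_pos|]. intros h Hh.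
  pose proof (Rmin_l d d'). pose proof (Rmin_r d d').
  specialize (Hx h ltac:(lra)). specialize (Hx' h ltac:(lra)).
  rewrite (linear_plus (T h) (sg_linear T HT h ltac:(lra))).
  match goal with |- norm ?E <= _ => replace E with
    (plus (minus (minus (T h x) x) (scal h y)) (minus (minus (T h x') x') (scal h y')))
    by module_eq end.
  apply Rle_trans with (1 := norm_triangle _ _). lra.
Qed.

Lemma generator_value_scal (a : R) (x y : V) :
  generator_value T x y -> generator_value T (scal a x) (scal a y).
Proof.
  rewrite !generator_value_iff. intros H e He.
  pose proof (Rabs_pos a) as Ha.
  destruct (H (e / (Rabs a + 1))) as [d [Hd Hx]].
  { apply Rdiv_lt_0_compat; lra. }
  exists d. split; [exact Hd|]. intros h Hh. specialize (Hx h Hh).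
  rewrite (linear_scal (T h) (sg_linear T HT h ltac:(lra))).
  match goal with |- norm ?E <= _ => replace E with
    (scal a (minus (minus (T h x) x) (scal h y))) by module_eq end.
  rewrite norm_scal_real.
  apply Rle_trans with (Rabs a * (e / (Rabs a + 1) * h)).
  - apply Rmult_le_compat_l; [exact Ha|exact Hx].
  - assert (Hle : Rabs a * (e / (Rabs a + 1)) <= e).
    { apply Rle_trans with ((Rabs a + 1) * (e / (Rabs a + 1))).
      - apply Rmult_le_compat_r; [|lra].
        apply Rlt_le, Rdiv_lt_0_compat; lra.
      - right; field; lra. }
    nra.
Qed.

Lemma generator_value_semigroup (x y : V) (t : R) : 0 <= t ->
  generator_value T x y -> generator_value T (T t x) (T t y).
Proof.
  intros Ht. rewrite !generator_value_iff. intros H e He.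
  pose proof (sg_linear T HT t Ht) as HTt.
  destruct (linear_norm (T t) HTt) as [M [HM HTM]].
  destruct (H (e / M)) as [d [Hd Hx]]; [apply Rdiv_lt_0_compat; lra|].
  exists d. split; [exact Hd|]. intros h Hh. specialize (Hx h Hh).
  rewrite <- (sg_plus T HT h t), (Rplus_comm h t), (sg_plus T HT) by lra.
  rewrite <- (linear_scal (T t) HTt), <- !(linear_minus (T t) _ _ HTt).
  apply Rle_trans with (1 := HTM _).
  apply Rle_trans with (M * (e / M * h)).
  - apply Rmult_le_compat_l; [lra|exact Hx].
  - right; field; lra.
Qed.

End Generators.

Section HeldState.

Context {V : CompleteNormedModule R_AbsRing} (T : R -> V -> V).
Hypothesis HT : semigroup T.

Lemma semigroup_integral_shift (w : V) (s h : R) : 0 <= s -> 0 <= h ->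
  T h (RInt (orbit T w) 0 s) = RInt (orbit T w) h (s + h).
Proof.
  intros Hs Hh.
  rewrite <- (RInt_linear (T h) (orbit T w)); [|now apply sg_linear|
    intros r; now apply orbit_continuous].
  transitivity (RInt (orbit T w) (1 * 0 + h) (1 * s + h)).
  - rewrite <- (RInt_comp_lin (V := V)) by now apply orbit_ex_RInt.
    apply (RInt_ext (V := V)). intros r Hr.
    rewrite Rmin_left in Hr by lra. rewrite !orbit_nonneg by lra.
    rewrite (scal_one (T (1 * r + h) w) : scal 1 _ = _).
    rewrite <- (sg_plus T HT) by lra. f_equal. ring.
  - now rewrite Rmult_0_r, Rplus_0_l, Rmult_1_l.
Qed.

Lemma orbit_integral_plus (w : V) (s h : R) : 0 <= s -> 0 <= h ->
  RInt (orbit T w) 0 (s + h)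
    = plus (T h (RInt (orbit T w) 0 s)) (RInt (orbit T w) 0 h).
Proof.
  intros Hs Hh. rewrite semigroup_integral_shift by assumption.
  rewrite (plus_comm (RInt (orbit T w) h (s + h))).
  symmetry. apply (RInt_Chasles (V := V)); now apply orbit_ex_RInt.
Qed.

Lemma orbit_integral_small (w : V) (e r : R) : 0 < e -> 0 <= r ->
  exists d, 0 < d /\ forall h, 0 < h < d ->
    norm (minus (RInt (orbit T w) r (r + h)) (scal h (T r w))) <= e * h.
Proof.
  intros He Hr.
  destruct (proj1 (right_limit_iff (V := V) _ _)
    (RInt_right_derivative (orbit T w) r (orbit_continuous T HT w)) e He)
    as [d [Hd Hlim]].
  exists d. split; [exact Hd|]. intros h Hh. specialize (Hlim h Hh).
  rewrite (orbit_nonneg T w r Hr) in Hlim.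
  normed_structures. rewrite norm_difference_quotient in Hlim by lra.
  set (X := norm _) in *.
  replace X with (/ h * X * h) by (field; lra). nra.
Qed.

(** By the shift, the increment under [T h] is the integral over a short interval
    at [s] minus the one over a short interval at [0]. *)
Lemma orbit_integral_generator (w : V) (s : R) : 0 <= s ->
  generator_value T (RInt (orbit T w) 0 s) (minus (T s w) w).
Proof.
  intros Hs. apply (generator_value_iff (V := V)). intros e He.
  pose proof (fun r => orbit_integral_small w (e / 2) r ltac:(lra)) as Hderiv.
  destruct (Hderiv s Hs) as [d1 [Hd1 H1]].
  destruct (Hderiv 0 (Rle_refl 0)) as [d2 [Hd2 H2]].
  exists (Rmin d1 d2). split; [now apply Rmin_pos|]. intros h Hh.
  pose proof (Rmin_l d1 d2). pose proof (Rmin_r d1 d2).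
  specialize (H1 h ltac:(lra)). specialize (H2 h ltac:(lra)).
  rewrite Rplus_0_l, (sg_zero T HT) in H2.
  rewrite semigroup_integral_shift by lra.
  (* Both sides are the integral from 0 to [s + h]. *)
  assert (HC : plus (RInt (orbit T w) 0 h) (RInt (orbit T w) h (s + h))
    = plus (RInt (orbit T w) 0 s) (RInt (orbit T w) s (s + h))).
  { rewrite !(RInt_Chasles (V := V)) by now apply orbit_ex_RInt. reflexivity. }
  match goal with |- norm ?E <= _ => replace E with
    (minus (minus (RInt (orbit T w) s (s + h)) (scal h (T s w)))
      (minus (RInt (orbit T w) 0 h) (scal h w))) end.
  - normed_structures. apply Rle_trans with (1 := norm_minus_le _ _). lra.
  - replace (RInt (orbit T w) h (s + h)) with
      (minus (plus (RInt (orbit T w) 0 s) (RInt (orbit T w) s (s + h)))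
        (RInt (orbit T w) 0 h)).
    + module_eq.
    + rewrite <- HC. module_eq.
Qed.

(** Averages of the orbit of [z] over short intervals are in the domain and
    converge to [z]. *)
Lemma generator_domain_dense (z : V) (e : R) : 0 < e ->
  exists z' y', generator_value T z' y' /\ norm (minus z' z) < e.
Proof.
  intros He.
  destruct (proj1 (right_limit_iff (V := V) _ _)
    (RInt_right_derivative (orbit T z) 0 (orbit_continuous T HT z)) e He)
    as [d [Hd Hlim]].
  exists (scal (/ (d / 2)) (RInt (orbit T z) 0 (d / 2))),
    (scal (/ (d / 2)) (minus (T (d / 2) z) z)).
  split.
  - apply (generator_value_scal (V := V) T HT). apply orbit_integral_generator. lra.
  - specialize (Hlim (d / 2) ltac:(lra)).
    rewrite orbit_nonneg, (sg_zero T HT), Rplus_0_l in Hlim by lra. exact Hlim.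
Qed.

(** The mild solution of [x' = A x + w] with [x 0 = z], where [A] generates [T]. *)
Definition held_state (z w : V) (s : R) : V :=
  plus (orbit T z s) (RInt (orbit T w) 0 s).

Lemma held_state_zero (z w : V) : held_state z w 0 = z.
Proof.
  unfold held_state. rewrite orbit_nonneg, (sg_zero T HT), RInt_point by lra.
  apply plus_zero_r.
Qed.

Lemma held_state_continuous (z w : V) (s : R) : continuous (held_state z w) s.
Proof.
  apply (continuous_plus (V := V)); [now apply orbit_continuous|].
  apply (continuous_RInt_1 (V := V) (orbit T w) 0 s (fun r => RInt (orbit T w) 0 r)).
  apply filter_forall. intros r. apply (RInt_correct (V := V)).
  now apply orbit_ex_RInt.
Qed.

Lemma held_state_plus (z w : V) (s h : R) : 0 <= s -> 0 <= h ->
  held_state z w (s + h) = plus (T h (held_state z w s)) (RInt (orbit T w) 0 h).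
Proof.
  intros Hs Hh. unfold held_state.
  rewrite orbit_integral_plus by assumption.
  rewrite (linear_plus (T h) (sg_linear T HT h Hh)).
  rewrite !orbit_nonneg by lra.
  rewrite (Rplus_comm s h), (sg_plus T HT) by assumption.
  apply plus_assoc.
Qed.

(** Started in the domain, the state stays in it: the constant input contributes
    an integral of an orbit, which always lies there. *)
Lemma held_state_generator (z y w : V) (s : R) : 0 <= s ->
  generator_value T z y -> exists y', generator_value T (held_state z w s) y'.
Proof.
  intros Hs Hz. unfold held_state. rewrite orbit_nonneg by assumption.
  exists (plus (T s y) (minus (T s w) w)).
  apply (generator_value_plus (V := V) T HT).
  - now apply (generator_value_semigroup (V := V) T HT).
  - now apply orbit_integral_generator.
Qed.

End HeldState.

(** * Growth and contraction between two events *)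

(** Bounds the ratio of the decay norms at the ends of an interval between events,
    for any length from [tau_min] to [tau_max]; see [feedback_contraction]. *)
Definition contraction_factor (Gamma gamma m tau_min tau_max : R) : R :=
  1 - (1 - Gamma * m / gamma) * (exp (gamma * tau_min) - 1) / exp (gamma * tau_max).

Lemma contraction_factor_bounds (Gamma gamma m tau_min tau_max : R) :
  0 < gamma -> 0 <= Gamma * m < gamma -> 0 < tau_min < tau_max ->
  0 < contraction_factor Gamma gamma m tau_min tau_max < 1.
Proof.
  intros Hgamma Hm Htau. unfold contraction_factor.
  assert (HE0 : 1 < exp (gamma * tau_min))
    by (rewrite <- exp_0; apply exp_increasing; nra).
  assert (HE : exp (gamma * tau_min) < exp (gamma * tau_max))
    by (apply exp_increasing; nra).
  assert (Hq : 0 <= Gamma * m / gamma < 1).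
  { split.
    - apply Rmult_le_pos; [lra|]. now apply Rlt_le, Rinv_0_lt_compat.
    - apply (Rmult_lt_reg_r gamma); [exact Hgamma|].
      replace (Gamma * m / gamma * gamma) with (Gamma * m) by (field; lra). lra. }
  set (E := exp (gamma * tau_max)) in *.
  set (D := (1 - Gamma * m / gamma) * (exp (gamma * tau_min) - 1)).
  assert (HD : 0 < D < E) by (unfold D; nra).
  assert (HDE : D / E * E = D) by (field; lra).
  split; nra.
Qed.

Section HeldFeedback.

Context {V : CompleteNormedModule R_AbsRing}.
Variables (T S : R -> V -> V) (L : V -> V) (Gamma gamma : R).
Hypothesis HT : semigroup T.
Hypothesis HS : semigroup S.
Hypothesis HL : is_linear L.
Hypothesis Hgen : forall x y,
  generator_value T x y -> generator_value S x (plus y (L x)).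
Hypothesis HGamma : 1 <= Gamma.
Hypothesis Hgamma : 0 < gamma.
Hypothesis Hdecay :
  forall t x, 0 <= t -> norm (S t x) <= Gamma * exp (- gamma * t) * norm x.

Let feedback (z : V) (s : R) : V := held_state T z (L z) s.
Let N : V -> R := decay_norm S gamma.

(** The right difference quotients of [T] and [S] at a point [u] of the domain
    differ in the limit by [L u], and the held input contributes [L z]. So the
    state moves like the closed-loop semigroup [S] with the sampling error
    [z - u] as an additional input. *)
Lemma feedback_right_step (z y : V) (s e : R) :
  generator_value T z y -> 0 <= s -> 0 < e ->
  exists d, 0 < d /\ forall h, 0 < h < d ->
    norm (minus (feedback z (s + h))
      (plus (S h (feedback z s)) (scal h (L (minus z (feedback z s)))))) <= e * h.
Proof.
  intros Hz Hs He.
  destruct (held_state_generator T HT z y (L z) s Hs Hz) as [y' Hu].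
  pose proof (Hgen _ _ Hu) as HuS. fold (feedback z s) in Hu, HuS.
  destruct (proj1 (generator_value_iff (V := V) T _ _) Hu (e / 3) ltac:(lra))
    as [d1 [Hd1 H1]].
  destruct (proj1 (generator_value_iff (V := V) S _ _) HuS (e / 3) ltac:(lra))
    as [d2 [Hd2 H2]].
  destruct (orbit_integral_small T HT (L z) (e / 3) 0 ltac:(lra) (Rle_refl 0))
    as [d3 [Hd3 H3]].
  exists (Rmin d1 (Rmin d2 d3)). split; [repeat apply Rmin_pos; assumption|].
  intros h Hh.
  pose proof (Rmin_l d1 (Rmin d2 d3)). pose proof (Rmin_r d1 (Rmin d2 d3)).
  pose proof (Rmin_l d2 d3). pose proof (Rmin_r d2 d3).
  specialize (H1 h ltac:(lra)). specialize (H2 h ltac:(lra)).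
  specialize (H3 h ltac:(lra)).
  rewrite Rplus_0_l, (sg_zero T HT) in H3.
  assert (Hplus : feedback z (s + h)
    = plus (T h (feedback z s)) (RInt (orbit T (L z)) 0 h))
    by (apply held_state_plus; try assumption; lra).
  rewrite Hplus. set (u := feedback z s) in *.
  rewrite (linear_minus L z u HL : L (minus z u) = minus (L z) (L u)).
  (* The unknown generator value [y'] cancels. *)
  match goal with |- norm ?E <= _ => replace E with
    (plus (minus (minus (minus (T h u) u) (scal h y'))
             (minus (minus (S h u) u) (scal h (plus y' (L u)))))
          (minus (RInt (orbit T (L z)) 0 h) (scal h (L z)))) by module_eq end.
  normed_structures.
  apply Rle_trans with (1 := norm_triangle _ _).
  pose proof (norm_minus_le (minus (minus (T h u) u) (scal h y'))
    (minus (minus (S h u) u) (scal h (plus y' (L u))))) as Htri.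
  normed_structures. lra.
Qed.

Lemma feedback_continuous (z : V) (s : R) : continuous (feedback z) s.
Proof. now apply held_state_continuous. Qed.

(** By [feedback_right_step] the decay norm has right derivative at most
    [- gamma] times itself plus [Gamma * c]. *)
Lemma feedback_growth_domain (z y : V) (a b c : R) :
  generator_value T z y -> 0 <= a <= b -> 0 <= c ->
  (forall s, a < s < b -> norm (L (minus z (feedback z s))) <= c) ->
  exp (gamma * b) * N (feedback z b)
    <= exp (gamma * a) * N (feedback z a)
       + Gamma * c / gamma * (exp (gamma * b) - exp (gamma * a)).
Proof.
  intros Hz Hab Hc Herr.
  apply (right_gronwall (fun s => N (feedback z s))); [assumption|nra|lra| |].
  - intros s. apply (decay_norm_continuous (V := V)) with Gamma;
      [exact HS|exact Hdecay|exact HGamma|].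
    apply feedback_continuous.
  - intros s Hs e He.
    destruct (feedback_right_step z y s (e / Gamma) Hz ltac:(lra)) as [d [Hd Hstep]].
    { apply Rdiv_lt_0_compat; lra. }
    exists d. split; [exact Hd|]. intros h Hh. specialize (Hstep h Hh).
    specialize (Herr s Hs). set (u := feedback z s) in *.
    set (r := L (minus z u)) in *.
    apply Rle_trans with
      (1 := decay_norm_perturb (V := V) S Gamma gamma HS Hdecay _ (plus (S h u) (scal h r))).
    pose proof (decay_norm_plus (V := V) S Gamma gamma HS Hdecay (S h u) (scal h r)) as H1.
    pose proof (decay_norm_semigroup (V := V) S Gamma gamma HS Hdecay u h ltac:(lra)) as H2.
    pose proof (decay_norm_le_norm (V := V) S Gamma gamma Hdecay (scal h r)) as H3.
    pose proof (norm_scal_real (V := V) h r) as H4.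
    rewrite Rabs_right in H4 by lra.
    assert (H5 : Gamma * (h * norm r) <= Gamma * c * h).
    { rewrite <- Rmult_assoc, (Rmult_assoc Gamma c), (Rmult_comm c), <- Rmult_assoc.
      apply Rmult_le_compat_l; [apply Rmult_le_pos; lra|exact Herr]. }
    apply (Rmult_le_compat_l Gamma) in Hstep; [|lra].
    replace (Gamma * (e / Gamma * h)) with (e * h) in Hstep by (field; lra).
    normed_structures. rewrite H4 in H3. fold N in H1, H2, H3 |- *. 
    lra.
Qed.

Lemma orbit_linear (r : R) : is_linear (fun x => orbit T x r).
Proof. apply (sg_linear T HT), Rmax_l. Qed.

Lemma feedback_bounded (b : R) : exists K, 1 <= K /\
  forall z s, 0 <= s <= b -> norm (feedback z s) <= K * norm z.
Proof.
  destruct (semigroup_locally_bounded T HT b) as [M [HM1 HM]].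
  destruct (linear_norm L HL) as [l [Hl HLl]].
  exists (Rmax 1 (M + b * (M * l))). split; [apply Rmax_l|].
  intros z s Hs. pose proof (norm_ge_0 z) as Hpos.
  assert (Hint : is_RInt (orbit T (L z)) 0 s (RInt (orbit T (L z)) 0 s)).
  { apply (RInt_correct (V := V)). now apply orbit_ex_RInt. }
  apply (norm_RInt_le_const _ _ _ _ (M * (l * norm z))) in Hint; [|lra|].
  - apply Rle_trans with ((M + b * (M * l)) * norm z);
      [|apply Rmult_le_compat_r; [exact Hpos|apply Rmax_r]].
    unfold feedback, held_state. normed_structures.
    apply Rle_trans with (1 := norm_triangle _ _).
    assert ((s - 0) * (M * (l * norm z)) <= b * (M * (l * norm z))).
    { apply Rmult_le_compat_r; [|lra]. repeat apply Rmult_le_pos; lra. }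
    rewrite orbit_nonneg by lra.
    specialize (HM s z Hs). lra.
  - intros r Hr. rewrite orbit_nonneg by lra.
    apply Rle_trans with (1 := HM r _ ltac:(lra)).
    apply Rmult_le_compat_l; [lra|apply HLl].
Qed.

Lemma feedback_linear (s : R) : 0 <= s -> is_linear (fun z => feedback z s).
Proof.
  intros Hs. split.
  - intros x y. unfold feedback, held_state.
    rewrite (linear_plus _ (orbit_linear s) x y : orbit T (plus x y) s = _).
    replace (RInt (orbit T (L (plus x y))) 0 s)
      with (plus (RInt (orbit T (L x)) 0 s) (RInt (orbit T (L y)) 0 s)); [module_eq|].
    rewrite <- (RInt_plus (V := V)) by now apply orbit_ex_RInt.
    apply (RInt_ext (V := V)). intros r _.
    rewrite (linear_plus L HL x y : L (plus x y) = _).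
    symmetry. exact (linear_plus _ (orbit_linear r) (L x) (L y)).
  - intros a x. unfold feedback, held_state.
    rewrite (linear_scal _ (orbit_linear s) a x : orbit T (scal a x) s = _).
    replace (RInt (orbit T (L (scal a x))) 0 s)
      with (scal a (RInt (orbit T (L x)) 0 s)).
    { symmetry. exact (scal_distr_l a (orbit T x s) (RInt (orbit T (L x)) 0 s)). }
    rewrite <- (RInt_scal (V := V)) by now apply orbit_ex_RInt.
    apply (RInt_ext (V := V)). intros r _.
    rewrite (linear_scal L HL a x : L (scal a x) = _).
    symmetry. exact (linear_scal _ (orbit_linear r) a (L x)).
  - destruct (feedback_bounded s) as [K [HK HKb]].
    exists K. split; [lra|]. intros x. apply HKb. lra.
Qed.

Lemma feedback_error_linear (s : R) : 0 <= s ->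
  is_linear (fun z => L (minus z (feedback z s))).
Proof.
  intros Hs. pose proof (feedback_linear s Hs) as Hf.
  apply (is_linear_comp (fun z => minus z (feedback z s)) L); [|exact HL].
  split.
  - intros x y. rewrite (linear_plus _ Hf x y : feedback (plus x y) s = _).
    module_eq.
  - intros a x. rewrite (linear_scal _ Hf a x : feedback (scal a x) s = _).
    exact (eq_sym (scal_minus_distr_l (V := V) a x (feedback x s))).
  - destruct (feedback_bounded s) as [K [HK HKb]].
    exists (1 + K). split; [lra|]. intros x.
    apply Rle_trans with (1 := norm_minus_le _ _).
    specialize (HKb x s ltac:(lra)). lra.
Qed.

(** The supremum is finite because the semigroup is bounded on bounded time
    intervals; otherwise its real part would carry no information. *)
Lemma feedback_error_le_sup (b s : R) (z : V) : 0 <= s <= b ->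
  norm (L (minus z (feedback z s)))
    <= real (Lub_Rbar (fun r => exists tau, 0 <= tau <= b /\
         r = operator_norm (fun x => L (minus x (feedback x tau))))) * norm z.
Proof.
  intros Hs.
  apply Rle_trans with
    (1 := operator_norm_bound _ (feedback_error_linear s (proj1 Hs)) z).
  apply Rmult_le_compat_r; [apply norm_ge_0|].
  destruct (feedback_bounded b) as [K [HK HKb]].
  destruct (linear_norm L HL) as [l [Hl HLl]].
  apply (real_Lub_ge _ (l * (1 + K))); [|now exists s].
  intros r [tau [Htau ->]]. apply operator_norm_le; [nra|]. intros x.
  apply Rle_trans with (1 := HLl _). rewrite Rmult_assoc.
  apply Rmult_le_compat_l; [lra|]. normed_structures.
  apply Rle_trans with (1 := norm_minus_le _ _).
  specialize (HKb x tau Htau). lra.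
Qed.

(** For [z'] in the domain at distance [d] of [z], the hypothesis holds with [c]
    enlarged by a multiple of [d], and both sides of the conclusion change by a
    multiple of [d]. Here [Q * d] collects these changes. *)
Lemma feedback_growth (z : V) (a b c : R) :
  0 <= a <= b -> 0 <= c ->
  (forall s, a < s < b -> norm (L (minus z (feedback z s))) <= c) ->
  exp (gamma * b) * N (feedback z b)
    <= exp (gamma * a) * N (feedback z a)
       + Gamma * c / gamma * (exp (gamma * b) - exp (gamma * a)).
Proof.
  intros Hab Hc Herr. apply le_epsilon. intros e He.
  destruct (feedback_bounded b) as [K [HK HKb]].
  destruct (linear_norm L HL) as [l [Hl HLl]].
  set (Ea := exp (gamma * a)). set (Eb := exp (gamma * b)).
  assert (HEa : 0 < Ea) by apply exp_pos.
  assert (HE : Ea <= Eb) by (apply exp_le_mono; nra).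
  set (Q := Ea * (Gamma * K) + Gamma * (l * (1 + K)) / gamma * (Eb - Ea)
            + Eb * (Gamma * K)).
  assert (HGK : 0 <= Gamma * K) by nra.
  assert (HQ : 0 <= Q).
  { unfold Q. assert (0 <= Gamma * (l * (1 + K)) / gamma).
    { apply Rmult_le_pos; [nra|]. now apply Rlt_le, Rinv_0_lt_compat. }
    nra. }
  set (d := e / (Q + 1)).
  assert (Hd : 0 < d) by (apply Rdiv_lt_0_compat; lra).
  assert (HQd : Q * d <= e).
  { assert ((Q + 1) * d = e) by (unfold d; field; lra). lra. }
  destruct (generator_domain_dense T HT z d Hd) as [z' [y' [Hz' Hclose]]].
  assert (Hdist : forall s, 0 <= s <= b ->
    norm (minus (feedback z' s) (feedback z s)) <= K * d).
  { intros s Hs. pose proof (feedback_linear s (proj1 Hs)) as Hf.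
    assert (E : minus (feedback z' s) (feedback z s) = feedback (minus z' z) s)
      by exact (eq_sym (linear_minus _ z' z Hf)).
    rewrite E. apply Rle_trans with (1 := HKb _ s Hs).
    apply Rmult_le_compat_l; [lra|]. apply Rlt_le, Hclose. }
  assert (Hgrow : Eb * N (feedback z' b) <= Ea * N (feedback z' a)
    + Gamma * (c + l * (1 + K) * d) / gamma * (Eb - Ea)).
  { apply feedback_growth_domain with y'; [exact Hz'|exact Hab| |].
    { apply Rplus_le_le_0_compat; [exact Hc|].
      apply Rmult_le_pos; [apply Rmult_le_pos|]; lra. }
    intros s Hs.
    set (p := minus z (feedback z s)).
    set (q := minus (minus z' z) (minus (feedback z' s) (feedback z s))).
    assert (E : minus z' (feedback z' s) = plus p q) by (unfold p, q; module_eq).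
    normed_structures. rewrite E, (linear_plus L HL p q).
    apply Rle_trans with (1 := norm_triangle _ _).
    apply Rplus_le_compat; [now apply Herr|].
    apply Rle_trans with (1 := HLl _).
    rewrite Rmult_assoc. apply Rmult_le_compat_l; [lra|].
    normed_structures. apply Rle_trans with (1 := norm_minus_le _ _).
    specialize (Hdist s ltac:(lra)). normed_structures. lra. }
  pose proof (decay_norm_perturb (V := V) S Gamma gamma HS Hdecay
    (feedback z b) (feedback z' b)) as H1.
  pose proof (decay_norm_perturb (V := V) S Gamma gamma HS Hdecay
    (feedback z' a) (feedback z a)) as H2.
  pose proof (Hdist a ltac:(lra)) as Hda. pose proof (Hdist b ltac:(lra)) as Hdb.
  fold N in H1, H2. normed_structures.
  rewrite norm_minus_sym in H1.
  assert (H1' : Eb * N (feedback z b)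
    <= Eb * N (feedback z' b) + Eb * (Gamma * (K * d))).
  { rewrite <- Rmult_plus_distr_l. apply Rmult_le_compat_l; [lra|].
    apply Rle_trans with (1 := H1). apply Rplus_le_compat_l.
    apply Rmult_le_compat_l; lra. }
  assert (H2' : Ea * N (feedback z' a)
    <= Ea * N (feedback z a) + Ea * (Gamma * (K * d))).
  { rewrite <- Rmult_plus_distr_l. apply Rmult_le_compat_l; [lra|].
    apply Rle_trans with (1 := H2). apply Rplus_le_compat_l.
    apply Rmult_le_compat_l; lra. }
  assert (HQ' : Q * d = Ea * (Gamma * (K * d))
    + Gamma * (l * (1 + K) * d) / gamma * (Eb - Ea) + Eb * (Gamma * (K * d)))
    by (unfold Q; field; lra).
  replace (Gamma * (c + l * (1 + K) * d) / gamma * (Eb - Ea))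
    with (Gamma * c / gamma * (Eb - Ea)
          + Gamma * (l * (1 + K) * d) / gamma * (Eb - Ea)) in Hgrow by (field; lra).
  lra.
Qed.

Section OnePeriod.

Variables (z : V) (l m eps tau_min tau_max tau : R).
Hypothesis Hl : forall x, norm (L x) <= l * norm x.
Hypothesis Hl0 : 0 <= l.
Hypothesis Hm0 : 0 <= m.
Hypothesis Heps0 : 0 <= eps.
Hypothesis Htau_min : 0 < tau_min.
Hypothesis Hm : Gamma * m < gamma.
Hypothesis Heps : Gamma * (eps * l) < gamma.
Hypothesis Hearly : forall s, 0 <= s <= tau_min ->
  norm (L (minus z (feedback z s))) <= m * norm z.
Hypothesis Hlate : forall s, tau_min < s < tau ->
  norm (minus z (feedback z s)) <= eps * norm z.

Lemma div_gamma_lt_one (q : R) : q < gamma -> q / gamma < 1.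
Proof.
  intros Hq. apply (Rmult_lt_reg_r gamma); [exact Hgamma|].
  replace (q / gamma * gamma) with q by (field; lra). lra.
Qed.

Lemma feedback_early (s : R) : 0 <= s <= tau_min ->
  exp (gamma * s) * N (feedback z s)
    <= N z * (1 + Gamma * m / gamma * (exp (gamma * s) - 1)).
Proof.
  intros Hs.
  pose proof (norm_le_decay_norm (V := V) S Gamma gamma HS Hdecay z) as Hz.
  fold N in Hz. pose proof (norm_ge_0 z) as Hz0.
  pose proof (feedback_growth z 0 s (m * N z)) as H.
  assert (H0 : feedback z 0 = z) by now apply held_state_zero.
  rewrite H0, Rmult_0_r, exp_0, Rmult_1_l in H.
  replace (N z * (1 + Gamma * m / gamma * (exp (gamma * s) - 1)))
    with (N z + Gamma * (m * N z) / gamma * (exp (gamma * s) - 1)) by (field; lra).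
  apply H; [lra| |].
  - apply Rmult_le_pos; lra.
  - intros r Hr. apply Rle_trans with (1 := Hearly r ltac:(lra)).
    apply Rmult_le_compat_l; lra.
Qed.

(** The growth estimate is applied twice: with the error bound [m * norm z] up
    to [tau_min], then with [eps * l * norm z] up to [tau]. The second rate is
    below [gamma], so the second stretch adds at most [N z] times the
    increase of [exp (gamma * s)], and the gain of the first stretch is kept. *)
Lemma feedback_late : tau_min <= tau ->
  exp (gamma * tau) * N (feedback z tau)
    <= N z * (exp (gamma * tau)
              - (1 - Gamma * m / gamma) * (exp (gamma * tau_min) - 1)).
Proof.
  intros Htau.
  pose proof (norm_le_decay_norm (V := V) S Gamma gamma HS Hdecay z) as Hz.
  fold N in Hz. pose proof (norm_ge_0 z) as Hz0.
  pose proof (feedback_early tau_min ltac:(lra)) as H1.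
  assert (H2 : exp (gamma * tau) * N (feedback z tau)
    <= exp (gamma * tau_min) * N (feedback z tau_min)
       + Gamma * (eps * l * N z) / gamma * (exp (gamma * tau) - exp (gamma * tau_min))).
  { apply feedback_growth; [lra| |].
    - repeat apply Rmult_le_pos; lra.
    - intros r Hr. apply Rle_trans with (1 := Hl _).
      apply Rle_trans with (l * (eps * norm z)).
      + apply Rmult_le_compat_l; [exact Hl0|]. exact (Hlate r Hr).
      + replace (l * (eps * norm z)) with (eps * l * norm z) by ring.
        apply Rmult_le_compat_l; [nra|exact Hz]. }
  assert (HE : exp (gamma * tau_min) <= exp (gamma * tau)) by (apply exp_le_mono; nra).
  pose proof (div_gamma_lt_one _ Heps) as Hq.
  set (E := exp (gamma * tau)) in *. set (E0 := exp (gamma * tau_min)) in *.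
  set (q1 := Gamma * m / gamma) in *.
  replace (Gamma * (eps * l * N z) / gamma) with (Gamma * (eps * l) / gamma * N z) in H2
    by (field; lra).
  set (q2 := Gamma * (eps * l) / gamma) in *.
  assert (q2 * N z * (E - E0) <= N z * (E - E0)).
  { apply Rmult_le_compat_r; nra. }
  lra.
Qed.

Lemma feedback_nonincreasing : 0 <= tau -> N (feedback z tau) <= N z.
Proof.
  intros Htau.
  pose proof (norm_le_decay_norm (V := V) S Gamma gamma HS Hdecay z) as Hz.
  fold N in Hz. pose proof (norm_ge_0 z) as Hz0.
  pose proof (div_gamma_lt_one _ Hm) as Hq.
  pose proof (exp_pos (gamma * tau)) as HE.
  assert (HE1 : 1 <= exp (gamma * tau))
    by (rewrite <- exp_0; apply exp_le_mono; nra).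
  apply (Rmult_le_reg_l (exp (gamma * tau))); [exact HE|].
  destruct (Rle_dec tau tau_min) as [Hle|Hgt].
  - apply Rle_trans with (1 := feedback_early tau ltac:(lra)).
    rewrite (Rmult_comm (exp _)). apply Rmult_le_compat_l; [lra|].
    nra.
  - apply Rle_trans with (1 := feedback_late ltac:(lra)).
    rewrite (Rmult_comm (exp _)). apply Rmult_le_compat_l; [lra|].
    assert (1 <= exp (gamma * tau_min))
      by (rewrite <- exp_0; apply exp_le_mono; nra).
    nra.
Qed.

(** The gain kept in [feedback_late] does not depend on [tau]; relative to
    [exp (gamma * tau)] it is smallest at [tau_max]. *)
Lemma feedback_contraction : tau_min <= tau <= tau_max ->
  N (feedback z tau) <= contraction_factor Gamma gamma m tau_min tau_max * N z.
Proof.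
  intros Htau.
  pose proof (norm_le_decay_norm (V := V) S Gamma gamma HS Hdecay z) as Hz.
  fold N in Hz. pose proof (norm_ge_0 z) as Hz0.
  pose proof (div_gamma_lt_one _ Hm) as Hq.
  pose proof (feedback_late ltac:(lra)) as H.
  pose proof (exp_pos (gamma * tau)) as HE.
  assert (HE1 : exp (gamma * tau) <= exp (gamma * tau_max)) by (apply exp_le_mono; nra).
  assert (HE0 : 1 <= exp (gamma * tau_min))
    by (rewrite <- exp_0; apply exp_le_mono; nra).
  apply (Rmult_le_reg_l (exp (gamma * tau))); [exact HE|].
  apply Rle_trans with (1 := H). unfold contraction_factor.
  set (E := exp (gamma * tau)) in *. set (Em := exp (gamma * tau_max)) in *.
  set (D := (1 - Gamma * m / gamma) * (exp (gamma * tau_min) - 1)).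
  assert (HD : 0 <= D) by (unfold D; nra).
  assert (HED : E * (D / Em) <= D).
  { replace D with (Em * (D / Em)) at 2 by (field; lra).
    apply Rmult_le_compat_r; [|exact HE1].
    apply Rmult_le_pos; [exact HD|]. apply Rlt_le, Rinv_0_lt_compat; lra. }
  replace (E * ((1 - D / Em) * N z)) with (N z * (E - E * (D / Em))) by ring.
  apply Rmult_le_compat_l; lra.
Qed.

End OnePeriod.

End HeldFeedback.

(** * Trajectories of the event-triggered loop *)

Section Gluing.

Context {V : NormedModule R_AbsRing}.

Lemma glue_continuous (f g : R -> V) (c s : R) :
  (forall r, continuous f r) -> (forall r, continuous g r) -> f c = g c ->
  continuous (fun r => if Rle_dec r c then f r else g r) s.
Proof.
  intros Hf Hg Hc. apply continuous_norm_iff. intros e He.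
  destruct (proj1 (continuous_norm_iff f s) (Hf s) e He) as [d1 [Hd1 H1]].
  destruct (proj1 (continuous_norm_iff g s) (Hg s) e He) as [d2 [Hd2 H2]].
  destruct (Rtotal_order s c) as [Hs|[Hs|Hs]].
  - exists (Rmin d1 (c - s)). split; [apply Rmin_pos; lra|]. intros r Hr.
    pose proof (Rmin_l d1 (c - s)). pose proof (Rmin_r d1 (c - s)).
    pose proof (Rabs_def2 _ _ Hr).
    destruct (Rle_dec r c); [|lra]. destruct (Rle_dec s c); [|lra].
    apply H1. lra.
  - exists (Rmin d1 d2). split; [now apply Rmin_pos|]. intros r Hr.
    pose proof (Rmin_l d1 d2). pose proof (Rmin_r d1 d2).
    destruct (Rle_dec s c); [|lra].
    destruct (Rle_dec r c); [apply H1; lra|].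
    rewrite Hs, Hc, <- Hs. apply H2. lra.
  - exists (Rmin d2 (s - c)). split; [apply Rmin_pos; lra|]. intros r Hr.
    pose proof (Rmin_l d2 (s - c)). pose proof (Rmin_r d2 (s - c)).
    pose proof (Rabs_def2 _ _ Hr).
    destruct (Rle_dec r c); [lra|]. destruct (Rle_dec s c); [lra|].
    apply H2. lra.
Qed.

End Gluing.

Section EventTriggering.

Context {k : scalar_field} {X U : Hilbert k}.
Variables (T : R -> X -> X) (B : U -> X) (F : X -> U).
Variables (eps tau_min tau_max : R).
Hypothesis Htau_min : 0 < tau_min < tau_max.

Lemma trigger_time_ge (tk : R) (z : X) :
  Rbar_le (tk + tau_min) (trigger_time T B F eps tau_min tk z).
Proof.
  unfold trigger_time. apply (proj2 (Glb_Rbar_correct _)).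
  intros r [Hr _]. simpl. lra.
Qed.

Lemma trigger_time_quiet (tk s : R) (z : X) :
  tk + tau_min < s -> Rbar_lt s (trigger_time T B F eps tau_min tk z) ->
  norm (minus z (held_flow T B F z (s - tk))) <= eps * norm z.
Proof.
  intros Hs Hlt. apply Rnot_lt_le. intros Hgt.
  apply (Rbar_lt_not_le _ _ Hlt). unfold trigger_time.
  apply (proj1 (Glb_Rbar_correct _)). split; [exact Hs|exact Hgt].
Qed.

Definition next_time (tk : R) (z : X) : R :=
  real (Rbar_min (tk + tau_max) (trigger_time T B F eps tau_min tk z)).

(** The trigger time may be infinite but is never below [tk + tau_min], so the
    minimum is a real number. *)
Lemma next_time_finite (tk : R) (z : X) :
  Finite (next_time tk z)
    = Rbar_min (tk + tau_max) (trigger_time T B F eps tau_min tk z).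
Proof.
  unfold next_time. pose proof (trigger_time_ge tk z) as H.
  destruct (trigger_time _ _ _ _ _ _ _); simpl in *; [reflexivity|reflexivity|tauto].
Qed.

Lemma event_time_bounds (tk t' : R) (z : X) :
  Finite t' = Rbar_min (tk + tau_max) (trigger_time T B F eps tau_min tk z) ->
  tk + tau_min <= t' <= tk + tau_max.
Proof.
  intros H. pose proof (trigger_time_ge tk z) as Hge.
  destruct (trigger_time _ _ _ _ _ _ _) as [r| |]; simpl in *.
  - injection H as ->. unfold Rmin. destruct (Rle_dec _ _); lra.
  - injection H as ->. lra.
  - tauto.
Qed.

Lemma event_time_quiet (tk t' s : R) (z : X) :
  Finite t' = Rbar_min (tk + tau_max) (trigger_time T B F eps tau_min tk z) ->
  tk + tau_min < s < t' ->
  norm (minus z (held_flow T B F z (s - tk))) <= eps * norm z.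
Proof.
  intros H Hs. apply trigger_time_quiet; [lra|].
  destruct (trigger_time _ _ _ _ _ _ _) as [r| |]; simpl in *.
  - injection H as ->. pose proof (Rmin_r (tk + tau_max) r). lra.
  - exact I.
  - discriminate.
Qed.

Section Existence.

Variables (flow : X -> R -> X) (x0 : X).
Hypothesis Hflow : forall z s, 0 <= s -> held_flow T B F z s = flow z s.
Hypothesis Hflow_zero : forall z, flow z 0 = z.
Hypothesis Hflow_cont : forall z s, continuous (flow z) s.

Fixpoint sample (n : nat) : R * X :=
  match n with
  | O => (0, x0)
  | S m =>
      let t' := next_time (fst (sample m)) (snd (sample m)) in
      (t', flow (snd (sample m)) (t' - fst (sample m)))
  end.

Definition event_time (n : nat) : R := fst (sample n).

(** The trajectory in which no event after the [n]-th one is taken into account.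
    It is correct up to the time of event [n + 1]. *)
Fixpoint partial_trajectory (n : nat) (s : R) : X :=
  match n with
  | O => flow x0 s
  | S m =>
      if Rle_dec s (event_time (S m)) then partial_trajectory m s
      else flow (snd (sample (S m))) (s - event_time (S m))
  end.

Lemma event_time_step (n : nat) : event_time n + tau_min <= event_time (S n).
Proof.
  apply (event_time_bounds _ _ (snd (sample n))), next_time_finite.
Qed.

Lemma event_time_mono (n m : nat) : (n <= m)%nat -> event_time n <= event_time m.
Proof.
  induction 1 as [|m Hm IH]; [lra|]. pose proof (event_time_step m). lra.
Qed.

Lemma event_time_ge (n : nat) : INR n * tau_min <= event_time n.
Proof.
  induction n as [|n IH].
  - unfold event_time. simpl. lra.
  - pose proof (event_time_step n). rewrite S_INR. lra.
Qed.

Lemma partial_trajectory_agree (n m : nat) (s : R) :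
  (n <= m)%nat -> s <= event_time (S n) ->
  partial_trajectory m s = partial_trajectory n s.
Proof.
  intros Hnm Hs. induction Hnm as [|m Hm IH]; [reflexivity|].
  cbn [partial_trajectory].
  pose proof (event_time_mono (S n) (S m) ltac:(lia)).
  destruct (Rle_dec s (event_time (S m))); [exact IH|lra].
Qed.

Lemma partial_trajectory_flow (n : nat) (s : R) :
  event_time n <= s -> partial_trajectory n s = flow (snd (sample n)) (s - event_time n).
Proof.
  revert s. induction n as [|n IH]; intros s Hs.
  - unfold event_time. simpl. now rewrite Rminus_0_r.
  - cbn [partial_trajectory]. destruct (Rle_dec s (event_time (S n))) as [Hle|]; [|reflexivity].
    replace s with (event_time (S n)) by lra.
    pose proof (event_time_step n). rewrite IH by lra.
    replace (event_time (S n) - event_time (S n)) with 0 by ring.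
    rewrite Hflow_zero. reflexivity.
Qed.

Lemma partial_trajectory_continuous (n : nat) (s : R) :
  continuous (partial_trajectory n) s.
Proof.
  revert s. induction n as [|n IH]; intros s; [apply Hflow_cont|].
  apply (glue_continuous (V := realify X) (partial_trajectory n)
    (fun r => flow (snd (sample (S n))) (r - event_time (S n)))).
  - exact IH.
  - intros r. apply (continuous_comp (fun r => r - event_time (S n))); [|apply Hflow_cont].
    apply (ex_derive_continuous (V := R_NormedModule)). auto_derive. exact I.
  - replace (event_time (S n) - event_time (S n)) with 0 by ring.
    rewrite Hflow_zero. rewrite partial_trajectory_flow; [reflexivity|].
    pose proof (event_time_step n). lra.
Qed.

(** Events are at least [tau_min] apart, so event number [stage s] occurs no
    earlier than [s]. This makes the limit of the partial trajectories
    explicit. *)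
Definition stage (s : R) : nat := Z.to_nat (up (s / tau_min)).

Lemma stage_le (s : R) : s <= INR (stage s) * tau_min.
Proof.
  unfold stage. destruct (archimed (s / tau_min)) as [Hup _].
  assert (Hs : s / tau_min <= INR (Z.to_nat (up (s / tau_min)))).
  { destruct (Z.le_gt_cases 0 (up (s / tau_min))) as [Hz|Hz].
    - rewrite INR_IZR_INZ, Z2Nat.id by exact Hz. lra.
    - assert (Hneg : IZR (up (s / tau_min)) < 0) by (apply IZR_lt; lia).
      pose proof (pos_INR (Z.to_nat (up (s / tau_min)))). lra. }
  apply (Rmult_le_compat_r tau_min) in Hs; [|lra].
  replace (s / tau_min * tau_min) with s in Hs by (field; lra). exact Hs.
Qed.

Definition trajectory (s : R) : X := partial_trajectory (stage s) s.

Lemma trajectory_eq (n : nat) (s : R) :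
  s <= event_time (S n) -> trajectory s = partial_trajectory n s.
Proof.
  intros Hs. unfold trajectory.
  assert (Hstage : s <= event_time (S (stage s))).
  { pose proof (stage_le s). pose proof (event_time_ge (stage s)).
    pose proof (event_time_step (stage s)). lra. }
  destruct (Nat.le_ge_cases n (stage s)).
  - now apply partial_trajectory_agree.
  - symmetry. now apply partial_trajectory_agree.
Qed.

(** Near [s] the trajectory coincides with one fixed partial trajectory. *)
Lemma trajectory_continuous (s : R) : continuous trajectory s.
Proof.
  set (n := stage (s + 1)).
  apply (continuous_ext_loc trajectory (partial_trajectory n));
    [|apply partial_trajectory_continuous].
  exists (mkposreal 1 Rlt_0_1). intros r Hr.
  pose proof (Rabs_def2 _ _ (Hr : Rabs (r - s) < 1)).
  symmetry. apply (trajectory_eq n r).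
  pose proof (stage_le (s + 1)) as Hstage. fold n in Hstage.
  pose proof (event_time_ge n). pose proof (event_time_step n). lra.
Qed.

Lemma trajectory_sample (n : nat) : trajectory (event_time n) = snd (sample n).
Proof.
  pose proof (event_time_step n).
  rewrite (trajectory_eq n) by lra. rewrite partial_trajectory_flow by lra.
  replace (event_time n - event_time n) with 0 by ring. apply Hflow_zero.
Qed.

Lemma closed_loop_solution_exists :
  closed_loop_solution T B F eps tau_min tau_max x0 event_time trajectory.
Proof.
  split.
  - reflexivity.
  - intros j. rewrite trajectory_sample. apply next_time_finite.
  - intros s _. apply (filterlim_filter_le_1 (F := locally s)); [|apply trajectory_continuous].
    exact (filter_le_within (fun r => 0 <= r)).
  - exact (trajectory_sample 0).
  - intros j tau Htau. rewrite trajectory_sample, Hflow by lra.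
    rewrite (trajectory_eq j) by lra. rewrite partial_trajectory_flow by lra.
    f_equal. ring.
Qed.

End Existence.

Section Decay.

Variables (x0 : X) (t : nat -> R) (x : R -> X) (N : X -> R) (theta : R).
Hypothesis Hsol : closed_loop_solution T B F eps tau_min tau_max x0 t x.
Hypothesis Htheta : 0 < theta < 1.
Hypothesis HN0 : forall z, 0 <= N z.
Hypothesis Hnonincr : forall j s, t j <= s <= t (S j) -> N (x s) <= N (x (t j)).
Hypothesis Hcontract : forall j, N (x (t (S j))) <= theta * N (x (t j)).

Lemma solution_time_bounds (j : nat) : t j + tau_min <= t (S j) <= t j + tau_max.
Proof.
  apply (event_time_bounds _ _ (x (t j))).
  exact (times_succ Hsol j).
Qed.

Lemma solution_period (s : R) : 0 <= s -> exists j, t j <= s <= t (S j).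
Proof.
  intros Hs.
  assert (Hn : forall n, t 0%nat <= s <= t n -> exists j, t j <= s <= t (S j)).
  { induction n as [|n IH]; intros Hn.
    - exists 0%nat. pose proof (solution_time_bounds 0). lra.
    - destruct (Rle_dec s (t n)) as [Hle|Hgt]; [apply IH; lra|].
      exists n. lra. }
  rewrite (times_zero Hsol) in Hn.
  apply (Hn (stage s)). split; [exact Hs|].
  apply Rle_trans with (1 := stage_le s).
  induction (stage s) as [|n IH].
  - rewrite (times_zero Hsol). simpl. lra.
  - rewrite S_INR. pose proof (solution_time_bounds n). lra.
Qed.

Lemma solution_samples_decay (j : nat) : N (x (t j)) <= theta ^ j * N x0.
Proof.
  induction j as [|j IH].
  - rewrite (times_zero Hsol), (solution_zero Hsol). simpl. lra.
  - apply Rle_trans with (1 := Hcontract j). simpl. rewrite Rmult_assoc.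
    apply Rmult_le_compat_l; lra.
Qed.

(** A time [s] between events [j] and [j + 1] is at most [(j + 1) * tau_max],
    which turns the factor [theta ^ j] into an exponential in [s]; the factor
    [/ theta] pays for the last, incomplete interval. *)
Lemma solution_decay (s : R) : 0 <= s ->
  N (x s) <= / theta * exp (- (- ln theta / tau_max) * s) * N x0.
Proof.
  intros Hs. destruct (solution_period s Hs) as [j Hj].
  apply Rle_trans with (1 := Hnonincr j s Hj).
  apply Rle_trans with (1 := solution_samples_decay j).
  apply Rmult_le_compat_r; [apply HN0|].
  assert (Ht : forall n, t n <= INR n * tau_max).
  { induction n as [|n IH]; [rewrite (times_zero Hsol); simpl; lra|].
    rewrite S_INR. pose proof (solution_time_bounds n). lra. }
  specialize (Ht (S j)). rewrite S_INR in Ht.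
  assert (Hln : ln theta < 0) by (rewrite <- ln_1; apply ln_increasing; lra).
  replace (/ theta) with (exp (- ln theta))
    by (rewrite exp_Ropp, exp_ln by lra; reflexivity).
  rewrite <- Rpower_pow by lra. unfold Rpower. rewrite <- exp_plus.
  apply exp_le_mono.
  assert (Hsj : s / tau_max <= INR j + 1).
  { apply (Rmult_le_reg_r tau_max); [lra|].
    replace (s / tau_max * tau_max) with s by (field; lra). lra. }
  replace (- (- ln theta / tau_max) * s) with (ln theta * (s / tau_max)) by (field; lra).
  nra.
Qed.

End Decay.

End EventTriggering.

(** * Hilbert spaces as real spaces, and the stability theorem *)

Section RealForm.

Context {k : scalar_field} {X U : Hilbert k}.

Lemma is_linear_realify (L : X -> U) :
  is_linear L -> is_linear (U := realify X) (V := realify U) L.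
Proof.
  intros HL. split.
  - exact (linear_plus L HL).
  - intros a x. exact (linear_scal L HL (of_real k a) x).
  - exact (linear_norm L HL).
Qed.

End RealForm.

Section RealFormSemigroup.

Context {k : scalar_field} {X U : Hilbert k}.

Lemma semigroup_realify (T : R -> X -> X) :
  C0_semigroup T -> semigroup (V := realify X) T.
Proof.
  intros HT. split.
  - intros t Ht. apply is_linear_realify, (semigroup_bounded HT Ht).
  - exact (semigroup_zero HT).
  - exact (semigroup_plus HT).
  - exact (semigroup_cont HT).
Qed.

Lemma generator_value_op_plus (A : operator X) (T S : R -> X -> X) (L : X -> X) :
  generates A T -> generates (op_plus A L) S ->
  forall x y, generator_value (V := realify X) T x y ->
    generator_value (V := realify X) S x (plus y (L x)).
Proof.
  intros [_ HA] [_ HAL] x y Hxy.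
  apply HA in Hxy. destruct Hxy as [Hdom Hact].
  apply HAL. simpl. split; [exact Hdom|now rewrite Hact].
Qed.

Variables (T : R -> X -> X) (B : U -> X) (F : X -> U).
Hypothesis HT : semigroup (V := realify X) T.

(** The substitution of [s - r] for [r] in the integral. *)
Lemma held_flow_held_state (z : X) (s : R) : 0 <= s ->
  held_flow T B F z s = held_state (V := realify X) T z (B (F z)) s.
Proof.
  intros Hs. unfold held_flow, held_state. rewrite (orbit_nonneg (V := realify X)) by exact Hs.
  apply f_equal. unfold integral.
  set (w := B (F z)). set (f := orbit (V := realify X) T w).
  assert (Hex : forall a b, ex_RInt (V := realify X) f a b)
    by (intros; now apply (orbit_ex_RInt (V := realify X))).
  transitivity (RInt (V := realify X) (fun r => opp (scal (-1) (f (-1 * r + s)))) 0 s).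
  - apply (RInt_ext (V := realify X)). intros r Hr.
    rewrite Rmin_left, Rmax_right in Hr by exact Hs.
    unfold f. rewrite (orbit_nonneg (V := realify X)) by lra.
    replace (-1 * r + s) with (s - r) by ring.
    set (v := T (s - r) w : realify X).
    change (v = opp (scal (-1) v)). module_eq.
  - assert (Hcomp : RInt (V := realify X) (fun r => scal (-1) (f (-1 * r + s))) 0 s
      = RInt (V := realify X) f s 0).
    { replace (RInt (V := realify X) f s 0)
        with (RInt (V := realify X) f (-1 * 0 + s) (-1 * s + s)) by (f_equal; ring).
      apply (RInt_comp_lin (V := realify X)), Hex. }
    rewrite (RInt_opp (V := realify X)).
    + rewrite Hcomp. apply (opp_RInt_swap (V := realify X)), Hex.
    + apply (ex_RInt_comp_lin (V := realify X)), Hex.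
Qed.

Lemma Delta_op_held_state (s : R) (z : X) : 0 <= s ->
  Delta_op T B F s z = held_state (V := realify X) T z (B (F z)) s.
Proof.
  intros Hs. unfold Delta_op, S_op, integral, held_state.
  rewrite (orbit_nonneg (V := realify X)) by exact Hs.
  apply f_equal, (RInt_ext (V := realify X)). intros r Hr.
  rewrite Rmin_left in Hr by exact Hs.
  rewrite (orbit_nonneg (V := realify X)) by lra. reflexivity.
Qed.

(** For [tau >= 0], [Delta_op] maps a sampled state to the state reached when the
    input is held for a time [tau]. *)
Lemma sampling_error_sup (b : R) :
  real (Lub_Rbar (fun r => exists tau, 0 <= tau <= b /\
    r = op_norm (fun x : X => B (F (minus x (Delta_op T B F tau x))))))
  = real (Lub_Rbar (fun r => exists tau, 0 <= tau <= b /\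
      r = operator_norm (V := realify X) (W := realify X)
            (fun x => B (F (minus x
              (held_state (V := realify X) T x (B (F x)) tau)))))).
Proof.
  apply f_equal, Lub_Rbar_eqset. intros r.
  assert (Hop : forall tau, 0 <= tau ->
    op_norm (fun x : X => B (F (minus x (Delta_op T B F tau x))))
    = op_norm (fun x : X => B (F (minus x
        (held_state (V := realify X) T x (B (F x)) tau))))).
  { intros tau Htau. f_equal. apply functional_extensionality. intros x.
    now rewrite Delta_op_held_state. }
  split; intros [tau [Htau ->]]; exists tau; (split; [exact Htau|]);
    [|symmetry]; apply Hop, Htau.
Qed.

End RealFormSemigroup.

(** The two inequalities that the contraction between events needs. The factors
    [exp (- gamma * tau)] and [exp (gamma * tau)] only strengthen the
    hypothesis. *)
Lemma threshold_margins (Gamma gamma M b eps tau : R) :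
  1 <= Gamma -> 0 < gamma -> 0 <= M -> 0 < b -> 0 <= eps -> 0 < tau ->
  eps < (gamma * exp (- gamma * tau) - Gamma * M) / (exp (gamma * tau) * Gamma * b) ->
  Gamma * M < gamma /\ Gamma * (eps * b) < gamma.
Proof.
  intros HGamma Hgamma HM Hb Heps Htau Hsmall.
  assert (HE : 1 <= exp (gamma * tau))
    by (rewrite <- exp_0; apply exp_le_mono; nra).
  assert (HE' : exp (- gamma * tau) <= 1)
    by (rewrite <- exp_0; apply exp_le_mono; nra).
  assert (Hden : 0 < exp (gamma * tau) * Gamma * b)
    by (repeat apply Rmult_lt_0_compat; lra).
  assert (Hnum : eps * (exp (gamma * tau) * Gamma * b)
    < gamma * exp (- gamma * tau) - Gamma * M).
  { revert Hsmall Hden. generalize (exp (gamma * tau) * Gamma * b).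
    intros D Hsmall HD. apply (Rmult_lt_compat_r D) in Hsmall; [|exact HD].
    unfold Rdiv in Hsmall.
    rewrite (Rmult_assoc _ (/ D)), Rinv_l, Rmult_1_r in Hsmall by lra.
    exact Hsmall. }
  assert (H1 : 0 <= Gamma * M) by (apply Rmult_le_pos; lra).
  assert (H2 : 0 <= Gamma * (eps * b)) by (repeat apply Rmult_le_pos; lra).
  assert (H3 : Gamma * (eps * b) <= eps * (exp (gamma * tau) * Gamma * b)).
  { replace (eps * (exp (gamma * tau) * Gamma * b))
      with (exp (gamma * tau) * (Gamma * (eps * b))) by ring.
    rewrite <- (Rmult_1_l (Gamma * (eps * b))) at 1.
    now apply Rmult_le_compat_r. }
  assert (H4 : gamma * exp (- gamma * tau) <= gamma * 1)
    by (apply Rmult_le_compat_l; lra).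
  split; lra.
Qed.

Theorem corollary2p11 :
  forall (k : scalar_field) (X U : Hilbert k)
    (A : operator X) (T : R -> X -> X) (B : U -> X) (F : X -> U)
    (TBF : R -> X -> X) (Gamma gamma : R),
  generates A T ->
  is_linear B ->
  compact_operator F ->
  (exists x : X, B (F x) <> zero) ->
  generates (op_plus A (fun x : X => B (F x))) TBF ->
  1 <= Gamma -> 0 < gamma ->
  (forall t : R, 0 <= t -> op_norm (TBF t) <= Gamma * exp (- gamma * t)) ->
  forall tau_max eps tau_min : R,
  0 < tau_max -> 0 <= eps -> 0 < tau_min < tau_max ->
  eps <
    (gamma * exp (- gamma * tau_min)
     - Gamma * real (Lub_Rbar (fun r => exists tau : R, 0 <= tau <= tau_min /\
         r = op_norm (fun x : X => B (F (minus x (Delta_op T B F tau x)))))))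
    / (exp (gamma * tau_min) * Gamma * op_norm (fun x : X => B (F x))) ->
  exponentially_stable T B F eps tau_min tau_max.
Proof.
  intros k X U A T B F TBF Gamma gamma HA HB [HF _] [x1 Hx1] HABF HGamma Hgamma
    HTBF tau_max eps tau_min _ Heps Htau Hsmall.
  pose proof (semigroup_realify T (proj1 HA)) as HT.
  pose proof (semigroup_realify TBF (proj1 HABF)) as HS.
  set (L := fun x : X => B (F x)) in *.
  assert (HL : is_linear (U := realify X) (V := realify X) L)
    by exact (is_linear_realify L (is_linear_comp F B HF HB)).
  pose proof (generator_value_op_plus A T TBF L HA HABF) as Hgen.
  set (flow := fun (z : X) (s : R) => held_state (V := realify X) T z (L z) s).
  assert (Hdecay : forall t (x : realify X), 0 <= t ->
    norm (TBF t x : realify X) <= Gamma * exp (- gamma * t) * norm x).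
  { intros t x Ht.
    apply Rle_trans with (1 := operator_norm_bound (V := realify X) (W := realify X)
      (TBF t) (sg_linear (V := realify X) TBF HS t Ht) x).
    apply Rmult_le_compat_r; [apply (norm_ge_0 (V := realify X))|exact (HTBF t Ht)]. }
  set (M := real (Lub_Rbar _)) in Hsmall.
  set (b := op_norm L) in Hsmall.
  assert (HM : forall (s : R) (z : X), 0 <= s <= tau_min ->
    norm (L (minus z (flow z s))) <= M * norm z).
  { intros s z Hs.
    pose proof (feedback_error_le_sup (V := realify X) T L HT HL tau_min s z Hs) as H.
    unfold M. rewrite (sampling_error_sup T B F). exact H. }
  assert (Hb : forall z, norm (L z) <= b * norm z)
    by exact (operator_norm_bound (V := realify X) (W := realify X) L HL).
  assert (Hpos : 0 < norm (L x1) /\ 0 < norm x1).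
  { assert (H1 : 0 < norm (L x1)).
    { destruct (norm_ge_0 (L x1)) as [H|H]; [exact H|].
      exfalso. apply Hx1. exact (norm_eq_zero (V := X) (L x1) (eq_sym H)). }
    split; [exact H1|].
    destruct (norm_ge_0 x1) as [H|H]; [exact H|].
    specialize (Hb x1). rewrite <- H in Hb. lra. }
  assert (Hb0 : 0 < b) by (specialize (Hb x1); nra).
  assert (HM0 : 0 <= M).
  { pose proof (HM 0 x1 ltac:(lra)) as H.
    pose proof (norm_ge_0 (L (minus x1 (flow x1 0)))). nra. }
  destruct (threshold_margins Gamma gamma M b eps tau_min) as [HGM HGeps];
    try assumption; try lra.
  set (N := decay_norm (V := realify X) TBF gamma).
  set (theta := contraction_factor Gamma gamma M tau_min tau_max).
  assert (Htheta : 0 < theta < 1)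
    by (apply contraction_factor_bounds; [| split; [apply Rmult_le_pos|]|]; lra).
  assert (Hlow : forall z : X, norm z <= N z)
    by exact (norm_le_decay_norm (V := realify X) TBF Gamma gamma HS Hdecay).
  assert (Hhigh : forall z : X, N z <= Gamma * norm z)
    by exact (decay_norm_le_norm (V := realify X) TBF Gamma gamma Hdecay).
  assert (Hflow : forall z s, 0 <= s -> held_flow T B F z s = flow z s)
    by (intros; now apply held_flow_held_state).
  assert (Hln : ln theta < 0) by (rewrite <- ln_1; apply ln_increasing; lra).
  exists (/ theta * Gamma), (- ln theta / tau_max).
  split; [|split].
  - rewrite <- (Rinv_1) at 1. 
    apply Rle_trans with (/ theta * 1).
    + rewrite Rmult_1_r. apply Rinv_le_contravar; lra.
    + apply Rmult_le_compat_l; [apply Rlt_le, Rinv_0_lt_compat|]; lra.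
  - apply Rdiv_lt_0_compat; lra.
  - intros x0. split.
    + exists (event_time T B F eps tau_min tau_max flow x0),
        (trajectory T B F eps tau_min tau_max flow x0).
      apply (closed_loop_solution_exists T B F eps tau_min tau_max Htau flow x0 Hflow).
      * intros z. now apply (held_state_zero (V := realify X)).
      * intros z s. now apply (held_state_continuous (V := realify X)).
    + intros t x Hsol s Hs.
      assert (Hx : forall j r, t j <= r <= t (S j) -> x r = flow (x (t j)) (r - t j)).
      { intros j r Hr. destruct (Req_dec r (t j)) as [->|Hne].
        - replace (t j - t j) with 0 by ring. symmetry.
          now apply (held_state_zero (V := realify X)).
        - replace r with (t j + (r - t j)) at 1 by ring.
          rewrite (solution_step Hsol j) by lra. apply Hflow. lra. }
      assert (Hlate : forall j r, r <= t (S j) -> forall q, tau_min < q < r - t j ->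
        norm (minus (x (t j)) (flow (x (t j)) q)) <= eps * norm (x (t j))).
      { intros j r Hr q Hq. rewrite <- Hflow by lra.
        replace q with (t j + q - t j) by ring.
        apply (event_time_quiet T B F eps tau_min tau_max (t j) (t (S j)));
          [exact (times_succ Hsol j)|lra]. }
      pose proof (solution_time_bounds T B F eps tau_min tau_max Htau x0 t x Hsol)
        as Hbounds.
      apply Rle_trans with (1 := Hlow (x s)).
      apply Rle_trans with
        (/ theta * exp (- (- ln theta / tau_max) * s) * N x0).
      * apply (solution_decay T B F eps tau_min tau_max Htau x0 t x N theta Hsol Htheta);
          [| | |exact Hs].
        -- intros z. apply Rle_trans with (2 := Hlow z). apply norm_ge_0.
        -- intros j r Hr. rewrite (Hx j r Hr).
           apply (feedback_nonincreasing (V := realify X) T TBF L Gamma gamma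
             HT HS HL Hgen HGamma Hgamma Hdecay (x (t j)) b M eps tau_min (r - t j));
             try assumption; try lra.
           ++ intros q Hq. now apply HM.
           ++ exact (Hlate j r (proj2 Hr)).
        -- intros j. specialize (Hbounds j). rewrite (Hx j (t (S j))) by lra.
           apply (feedback_contraction (V := realify X) T TBF L Gamma gamma
             HT HS HL Hgen HGamma Hgamma Hdecay (x (t j)) b M eps tau_min tau_max);
             try assumption; try lra.
           ++ intros q Hq. now apply HM.
           ++ exact (Hlate j (t (S j)) (Rle_refl _)).
      * replace (/ theta * Gamma * exp (- (- ln theta / tau_max) * s) * norm x0)
          with (/ theta * exp (- (- ln theta / tau_max) * s) * (Gamma * norm x0)) by ring.
        apply Rmult_le_compat_l; [|apply Hhigh].
        apply Rmult_le_pos; [apply Rlt_le, Rinv_0_lt_compat; lra|apply Rlt_le, exp_pos].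
Qed.
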